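(* Let $R$ be a perfect field with algebraic closure $\bar R$, and let $G_1,G_2$ be locally profinite groups such that $G_1\times G_2$ has an open subgroup of invertible pro-order in $R$. Let $(\pi_1,V_1)$ be an irreducible admissible representation in $\mathrm{Rep}_R(G_1)$, and let $\rho_1\in\mathrm{Rep}_{\bar R}(G_1)$ be an irreducible factor of $\pi_1\otimes_R\bar R$, so that $\pi_1\otimes_R\bar R\simeq m_1\big(\bigoplus_{w\in\mathrm{Hom}_R(R(\rho_1),\bar R)}{}^w\rho_1\big)$ for some integer $m_1\ge1$. Then for all $V\in\mathrm{Rep}_R(G_1\times G_2)$, we have $$V_{\pi_1}\otimes_R\bar R\simeq\bigoplus_{w\in\mathrm{Hom}_R(R(\rho_1),\bar R)}(V\otimes_R\bar R)_{{}^w\rho_1}.$$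
   Context: $\mathrm{Rep}_R(G)$ is the category of smooth $R[G]$-modules. For $\sigma\in\mathrm{Gal}_R(\bar R)$ and $\rho\in\mathrm{Rep}_{\bar R}(G)$, ${}^\sigma\rho$ is obtained by applying $\sigma$ to the matrix coefficients of $\rho$ in a basis (well defined up to isomorphism). The rationality field is $R(\rho_1)=\bar R^{H(\rho_1)}$ with $H(\rho_1)=\{\sigma\in\mathrm{Gal}_R(\bar R):{}^\sigma\rho_1\simeq\rho_1\}$; it is a finite extension of $R$. The Galois orbit of $\rho_1$ is in bijection with the set $\mathrm{Hom}_R(R(\rho_1),\bar R)$ of $R$-linear field embeddings; for such an embedding $w$, ${}^w\rho_1$ denotes ${}^\sigma\rho_1$ for any $\sigma\in\mathrm{Gal}_R(\bar R)$ extending $w$. For a field $k$, $U\in\mathrm{Rep}_k(G_1\times G_2)$ and an irreducible admissible $\pi\in\mathrm{Rep}_k(G_1)$, the largest $\pi$-isotypic quotient of $U$ is $U_\pi=U/\bigcap_{f\in\mathrm{Hom}_{G_1}(U,\pi)}\mathrm{Ker}(f)\in\mathrm{Rep}_k(G_1\times G_2)$. The pro-order of a compact open subgroup is the least common multiple of the cardinalities of its finite quotients. *)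

(* Defs.v *)
From HB Require Import structures.
From mathcomp Require Import all_boot all_order all_algebra all_field.
From mathcomp Require Import all_classical topology.

Set Implicit Arguments.
Unset Strict Implicit.
Unset Printing Implicit Defensive.

Import GRing.Theory.
Local Open Scope classical_set_scope.
Local Open Scope quotient_scope.
Local Open Scope ring_scope.

HB.mixin Record Group_isTopologicalGroup G of Group G & Topological G := {
  mulg_continuous : continuous (fun x : (G * G)%type => (x.1 * x.2)%g : G);
  invg_continuous : continuous (fun x : G => (x^-1)%g : G)
}.

#[short(type="topologicalGroupType")]
HB.structure Definition TopologicalGroup :=
  {G of Group G & Topological G & Group_isTopologicalGroup G}.

Section ProdTopologicalGroup.
Variables G H : topologicalGroupType.
Let GH : Type := (G * H)%type.

Fact prod_mulg_continuous :
  continuous (fun x : GH * GH => (x.1 * x.2)%g : GH).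
Proof.
have fst_cont (A B : topologicalType) : continuous (@fst A B).
  by move=> x; exact: cvg_fst.
have snd_cont (A B : topologicalType) : continuous (@snd A B).
  by move=> x; exact: cvg_snd.
move=> x; apply: cvg_pair => /=.
- apply: (@continuous2_cvg _ _ _ _ _ _ (fun y : GH * GH => y.1.1)
    (fun y : GH * GH => y.2.1) (fun a b : G => (a * b)%g)).
  + exact: (@mulg_continuous G (x.1.1, x.2.1)).
  + exact: (continuous_comp (fst_cont _ _ x) (fst_cont _ _ x.1)).
  + exact: (continuous_comp (snd_cont _ _ x) (fst_cont _ _ x.2)).
- apply: (@continuous2_cvg _ _ _ _ _ _ (fun y : GH * GH => y.1.2)
    (fun y : GH * GH => y.2.2) (fun a b : H => (a * b)%g)).
  + exact: (@mulg_continuous H (x.1.2, x.2.2)).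
  + exact: (continuous_comp (fst_cont _ _ x) (snd_cont _ _ x.1)).
  + exact: (continuous_comp (snd_cont _ _ x) (snd_cont _ _ x.2)).
Qed.

Fact prod_invg_continuous : continuous (fun x : GH => (x^-1)%g : GH).
Proof.
move=> x; apply: cvg_pair => /=.
- apply: (@continuous_comp GH G G fst (fun y => y^-1)%g x); first exact: cvg_fst.
  exact: (@invg_continuous G x.1).
- apply: (@continuous_comp GH H H snd (fun y => y^-1)%g x); first exact: cvg_snd.
  exact: (@invg_continuous H x.2).
Qed.

HB.instance Definition _ := Group_isTopologicalGroup.Build (G * H)%type
  prod_mulg_continuous prod_invg_continuous.

End ProdTopologicalGroup.

Definition is_subgroup (G : groupType) (H : set G) : Prop :=
  [/\ H 1%g, (forall x y, H x -> H y -> H (x * y)%g)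
    & (forall x, H x -> H (x^-1)%g)].

Definition compact_open_subgroup (G : topologicalGroupType) (K : set G) : Prop :=
  [/\ is_subgroup K, open K & compact K].

Definition locally_profinite (G : topologicalGroupType) : Prop :=
  hausdorff_space G /\
  forall U : set G, nbhs (1%g : G) U ->
    exists2 K : set G, compact_open_subgroup K & K `<=` U.

Section ProOrder.
Variable G : topologicalGroupType.
Implicit Types K N : set G.

Definition lcosets K N : set (set G) :=
  [set [set (g * h)%g | h in N] | g in K].

(* The finite quotients of a profinite group K are the K / N with N an open
   normal subgroup of K; n is the cardinality of one of them. *)
Definition finite_quotient_card K (n : nat) : Prop :=
  exists N : set G,
    [/\ is_subgroup N, open N, N `<=` K,
        (forall g h, K g -> N h -> N (g * h * g^-1)%g)
      & (lcosets K N #= `I_n)%card].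

(* The pro-order is a supernatural number, given here by the natural numbers
   that divide it: those that divide the lcm of finitely many of the
   cardinalities of the finite quotients. *)
Definition dvdn_pro_order (m : nat) K : Prop :=
  exists s : seq nat, (forall n, n \in s -> finite_quotient_card K n) /\
    (m %| \big[lcmn/1]_(n <- s) n)%N.

Definition pro_order_invertible (R : fieldType) K : Prop :=
  forall p : nat, p \in [pchar R] -> ~ dvdn_pro_order p K.

End ProOrder.

(* G is a bare group here: the topology enters through the predicates
   smooth and admissible below. *)
Record rep (k : fieldType) (G : groupType) := Rep {
  rep_mod :> lmodType k;
  rep_act : G -> {linear rep_mod -> rep_mod};
  rep_act1 : forall v, rep_act 1%g v = v;
  rep_actM : forall g h v, rep_act (g * h)%g v = rep_act g (rep_act h v)
}.
Arguments rep_act {k G} r g.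

Section RepTheory.
Variables (k : fieldType) (G : groupType).
Implicit Types U W : rep k G.

Definition equivariant U W (f : U -> W) : Prop :=
  forall g u, f (rep_act U g u) = rep_act W g (f u).

Definition rep_iso U W : Prop :=
  exists f : {linear U -> W}, bijective f /\ equivariant f.

Record subrep U := Subrep {
  subrep_set : set U;
  subrep0 : subrep_set 0;
  subrepP : forall (a : k) u v,
    subrep_set u -> subrep_set v -> subrep_set (a *: u + v);
  subrep_act : forall g u, subrep_set u -> subrep_set (rep_act U g u)
}.

Definition irreducible_rep U : Prop :=
  (exists u : U, u != 0) /\
  forall N : subrep U, subrep_set N = [set 0] \/ subrep_set N = setT.

End RepTheory.

Definition finite_dimensional (k : fieldType) (V : lmodType k) (W : set V) :
    Prop :=
  exists (n : nat) (e : 'I_n -> V), (forall i, W (e i)) /\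
    forall v, W v -> exists c : 'I_n -> k, v = \sum_i c i *: e i.

Section SmoothRep.
Variables (k : fieldType) (G : topologicalGroupType).
Implicit Types U : rep k G.

Definition smooth_rep U : Prop :=
  forall u : U, open [set g : G | rep_act U g u = u].

Definition invariants U (K : set G) : set U :=
  [set u | forall g, K g -> rep_act U g u = u].

Definition admissible_rep U : Prop :=
  smooth_rep U /\ forall K : set G, compact_open_subgroup K ->
    finite_dimensional (@invariants U K).

End SmoothRep.

Section Quotient.
Variables (k : fieldType) (G : groupType) (U : rep k G) (N : subrep U).

Definition quo_rel (u v : U) : bool := `[< subrep_set N (u - v) >].

Fact subrepZ (a : k) (u : U) : subrep_set N u -> subrep_set N (a *: u).
Proof. by move=> Nu; rewrite -[_ *: _]addr0; exact: subrepP (subrep0 N). Qed.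

Fact subrepD (u v : U) :
  subrep_set N u -> subrep_set N v -> subrep_set N (u + v).
Proof. by move=> Nu Nv; rewrite -[u]scale1r; exact: subrepP. Qed.

Fact quo_rel_equiv : equiv_class_of quo_rel.
Proof.
have sym u v : quo_rel u v -> quo_rel v u.
  by move/asboolP => Nuv; apply/asboolP; rewrite -opprB -scaleN1r; exact: subrepZ.
split=> [u|u v|v u w]; first by apply/asboolP; rewrite subrr; exact: subrep0.
  by apply/idP/idP; exact: sym.
move=> /asboolP Nuv /asboolP Nvw; apply/asboolP.
by rewrite -(subrK v u) -addrA; exact: subrepD.
Qed.

Canonical quo_equiv := EquivRelPack quo_rel_equiv.

Definition quo : Type := {eq_quot quo_equiv}.
HB.instance Definition _ := Choice.on quo.
HB.instance Definition _ := EqQuotient.on quo.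

Fact quo_piP (u v : U) : subrep_set N (u - v) -> \pi_quo u = \pi_quo v.
Proof. by move=> Nuv; apply/eqmodP/asboolP. Qed.

Fact quo_reprP (u : U) : subrep_set N (repr (\pi_quo u) - u).
Proof. by apply/asboolP; have /eqmodP := reprK (\pi_quo u). Qed.

Definition quo_add (x y : quo) : quo := \pi_quo (repr x + repr y).
Definition quo_scale (a : k) (x : quo) : quo := \pi_quo (a *: repr x).
Definition quo_opp (x : quo) : quo := quo_scale (-1) x.

Fact quo_pi_add u v : quo_add (\pi_quo u) (\pi_quo v) = \pi_quo (u + v).
Proof.
by apply: quo_piP; rewrite opprD addrACA; apply: subrepD; exact: quo_reprP.
Qed.

Fact quo_pi_scale a u : quo_scale a (\pi_quo u) = \pi_quo (a *: u).
Proof. by apply: quo_piP; rewrite -scalerBr; apply: subrepZ; exact: quo_reprP. Qed.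

Fact quoP (x : quo) : exists u, x = \pi_quo u.
Proof. by exists (repr x); rewrite reprK. Qed.

Fact quo_addA : associative quo_add.
Proof.
by move=> x y z; have [x0 ->] := quoP x;
  have [y0 ->] := quoP y; have [z0 ->] := quoP z;
  rewrite !quo_pi_add addrA.
Qed.

Fact quo_addC : commutative quo_add.
Proof.
by move=> x y; have [x0 ->] := quoP x; have [y0 ->] := quoP y;
  rewrite !quo_pi_add addrC.
Qed.

Fact quo_add0 : left_id (\pi_quo 0) quo_add.
Proof. by move=> x; have [x0 ->] := quoP x; rewrite quo_pi_add add0r. Qed.

Fact quo_addN : left_inverse (\pi_quo 0) quo_opp quo_add.
Proof.
by move=> x; have [x0 ->] := quoP x;
  rewrite /quo_opp quo_pi_scale quo_pi_add scaleN1r addNr.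
Qed.

HB.instance Definition _ := GRing.isZmodule.Build quo quo_addA quo_addC quo_add0 quo_addN.

Fact quo_piD u v : \pi_quo u + \pi_quo v = \pi_quo (u + v).
Proof. exact: quo_pi_add. Qed.

Fact quo_scaleA a b x : quo_scale a (quo_scale b x) = quo_scale (a * b) x.
Proof. by have [x0 ->] := quoP x; rewrite !quo_pi_scale scalerA. Qed.

Fact quo_scale1 : left_id 1 quo_scale.
Proof. by move=> x; have [x0 ->] := quoP x; rewrite quo_pi_scale scale1r. Qed.

Fact quo_scaleDr : right_distributive quo_scale +%R.
Proof.
move=> a x y; have [x0 ->] := quoP x; have [y0 ->] := quoP y.
by rewrite quo_piD !quo_pi_scale quo_piD scalerDr.
Qed.

Fact quo_scaleDl x : {morph quo_scale^~ x : a b / a + b}.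
Proof.
by move=> a b; have [x0 ->] := quoP x; rewrite !quo_pi_scale quo_piD scalerDl.
Qed.

HB.instance Definition _ := GRing.Zmodule_isLmodule.Build k quo
  quo_scaleA quo_scale1 quo_scaleDr quo_scaleDl.

Fact quo_piZ a u : a *: \pi_quo u = \pi_quo (a *: u).
Proof. exact: quo_pi_scale. Qed.

Definition quo_act (g : G) (x : quo) : quo := \pi_quo (rep_act U g (repr x)).

Fact quo_pi_act g u : quo_act g (\pi_quo u) = \pi_quo (rep_act U g u).
Proof.
by apply: quo_piP; rewrite -linearB; apply: subrep_act; exact: quo_reprP.
Qed.

Fact quo_act_linear g : linear (quo_act g).
Proof.
move=> a x y; have [x0 ->] := quoP x; have [y0 ->] := quoP y.
by rewrite quo_piZ quo_piD !quo_pi_act quo_piZ quo_piD linearP.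
Qed.

HB.instance Definition _ g :=
  GRing.isLinear.Build k quo quo _ (quo_act g) (quo_act_linear g).

Fact quo_act1 x : quo_act 1%g x = x.
Proof. by have [x0 ->] := quoP x; rewrite quo_pi_act rep_act1. Qed.

Fact quo_actM g h x : quo_act (g * h)%g x = quo_act g (quo_act h x).
Proof. by have [x0 ->] := quoP x; rewrite !quo_pi_act rep_actM. Qed.

Definition quo_rep : rep k G :=
  @Rep k G quo (fun g => quo_act g : {linear quo -> quo}) quo_act1 quo_actM.

End Quotient.

(* rho is an irreducible subquotient of U: it embeds in a quotient of U. *)
Definition irreducible_factor (k : fieldType) (G : groupType)
    (U rho : rep k G) : Prop :=
  irreducible_rep rho /\
  exists (N : subrep U) (f : {linear rho -> quo_rep N}),
    injective f /\ equivariant f.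

Section DirectSum.
Variables (k : fieldType) (G : groupType) (I : Type) (W : I -> rep k G).

Record dsum := Dsum {
  dsum_val : forall i, W i;
  dsum_fin : finite_set [set i | dsum_val i != 0]
}.

HB.instance Definition _ := gen_eqMixin dsum.
HB.instance Definition _ := gen_choiceMixin dsum.

Fact dsumP (x y : dsum) : (forall i, dsum_val x i = dsum_val y i) -> x = y.
Proof.
case: x y => [x xfin] [y yfin] /= eq_xy.
have {eq_xy} eq_xy : x = y by exact: functional_extensionality_dep.
by case: y / eq_xy yfin => yfin; congr Dsum; exact: Prop_irrelevance.
Qed.

Fact dsum0_fin : finite_set [set i | (0 : W i) != 0].
Proof.
by rewrite (_ : mkset _ = set0) // -subset0 => i /=; rewrite eqxx.
Qed.

Fact dsum_add_fin (x y : dsum) :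
  finite_set [set i | dsum_val x i + dsum_val y i != 0].
Proof.
apply: sub_finite_set (_ : _ `<=` [set i | dsum_val x i != 0] `|`
  [set i | dsum_val y i != 0]) _; last first.
  by rewrite finite_setU; split; exact: dsum_fin.
move=> i /=; case: (eqVneq (dsum_val x i) 0) => [->|]; last by left.
by rewrite add0r; right.
Qed.

Fact dsum_scale_fin (a : k) (x : dsum) :
  finite_set [set i | a *: dsum_val x i != 0].
Proof.
apply: sub_finite_set (dsum_fin x) => i /=.
by apply: contra_neq => ->; rewrite scaler0.
Qed.

Definition dsum_add x y := Dsum (dsum_add_fin x y).
Definition dsum_scale a x := Dsum (dsum_scale_fin a x).

Fact dsum_addA : associative dsum_add.
Proof. by move=> x y z; apply: dsumP => i /=; rewrite addrA. Qed.
Fact dsum_addC : commutative dsum_add.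
Proof. by move=> x y; apply: dsumP => i /=; rewrite addrC. Qed.
Fact dsum_add0 : left_id (Dsum dsum0_fin) dsum_add.
Proof. by move=> x; apply: dsumP => i /=; rewrite add0r. Qed.
Fact dsum_addN : left_inverse (Dsum dsum0_fin) (dsum_scale (-1)) dsum_add.
Proof. by move=> x; apply: dsumP => i /=; rewrite scaleN1r addNr. Qed.

HB.instance Definition _ := GRing.isZmodule.Build dsum
  dsum_addA dsum_addC dsum_add0 dsum_addN.

Fact dsum_scaleA a b x : dsum_scale a (dsum_scale b x) = dsum_scale (a * b) x.
Proof. by apply: dsumP => i /=; rewrite scalerA. Qed.
Fact dsum_scale1 : left_id 1 dsum_scale.
Proof. by move=> x; apply: dsumP => i /=; rewrite scale1r. Qed.
Fact dsum_scaleDr : right_distributive dsum_scale +%R.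
Proof. by move=> a x y; apply: dsumP => i /=; rewrite scalerDr. Qed.
Fact dsum_scaleDl x : {morph dsum_scale^~ x : a b / a + b}.
Proof. by move=> a b; apply: dsumP => i /=; rewrite scalerDl. Qed.

HB.instance Definition _ := GRing.Zmodule_isLmodule.Build k dsum
  dsum_scaleA dsum_scale1 dsum_scaleDr dsum_scaleDl.

Fact dsum_act_fin g (x : dsum) :
  finite_set [set i | rep_act (W i) g (dsum_val x i) != 0].
Proof.
apply: sub_finite_set (dsum_fin x) => i /=.
by apply: contra_neq => ->; rewrite linear0.
Qed.

Definition dsum_act g (x : dsum) : dsum := Dsum (dsum_act_fin g x).

Fact dsum_act_linear g : linear (dsum_act g).
Proof. by move=> a x y; apply: dsumP => i /=; rewrite linearP. Qed.

HB.instance Definition _ g :=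
  GRing.isLinear.Build k dsum dsum _ (dsum_act g) (dsum_act_linear g).

Fact dsum_act1 x : dsum_act 1%g x = x.
Proof. by apply: dsumP => i /=; rewrite rep_act1. Qed.
Fact dsum_actM g h x : dsum_act (g * h)%g x = dsum_act g (dsum_act h x).
Proof. by apply: dsumP => i /=; rewrite rep_actM. Qed.

Definition dsum_rep : rep k G :=
  @Rep k G dsum (fun g => dsum_act g : {linear dsum -> dsum})
    dsum_act1 dsum_actM.

End DirectSum.

Section IsotypicQuotient.
Variables (k : fieldType) (G1 G2 : groupType).
Variables (U : rep k (G1 * G2)%type) (pi : rep k G1).

Definition equivariant1 (f : U -> pi) : Prop :=
  forall g u, f (rep_act U (g, 1%g) u) = rep_act pi g (f u).

Definition isotypic_ker_set : set U :=
  [set u | forall f : {linear U -> pi}, equivariant1 f -> f u = 0].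

Fact isotypic_ker0 : isotypic_ker_set 0.
Proof. by move=> f _; rewrite linear0. Qed.

Fact isotypic_kerP (a : k) u v :
  isotypic_ker_set u -> isotypic_ker_set v -> isotypic_ker_set (a *: u + v).
Proof.
by move=> ku kv f ef; rewrite linearP ku // kv // scaler0 addr0.
Qed.

Fact isotypic_ker_act g u :
  isotypic_ker_set u -> isotypic_ker_set (rep_act U g u).
Proof.
case: g => g1 g2 ku f ef.
have eg : ((g1, g2) = (g1, 1) * (1, g2) :> G1 * G2)%g.
  by congr (_, _); rewrite ?mulg1 ?mul1g.
rewrite eg rep_actM ef; set f2 : {linear U -> pi} := f \o rep_act U (1%g, g2).
rewrite -[f _]/(f2 u) ku ?linear0 // => h v.
rewrite /f2 /= -rep_actM -ef -rep_actM; congr (f (rep_act U _ v)).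
by congr (_, _); rewrite /= ?mulg1 ?mul1g.
Qed.

Definition isotypic_ker : subrep U :=
  Subrep isotypic_ker0 isotypic_kerP isotypic_ker_act.

Definition isotypic_quotient : rep k (G1 * G2)%type := quo_rep isotypic_ker.

End IsotypicQuotient.

Section BaseChange.
Variables (R L : fieldType) (iota : {rmorphism R -> L}).

Section Tensor.
Variable V : lmodType R.

(* Elements of V (x)_R L are formal finite sums of pure tensors modulo the
   congruence generated by the bilinearity relations. *)
Inductive tensor_rel : seq (V * L) -> seq (V * L) -> Prop :=
| tensor_refl s : tensor_rel s s
| tensor_sym s t : tensor_rel s t -> tensor_rel t s
| tensor_trans t s u : tensor_rel s t -> tensor_rel t u -> tensor_rel s u
| tensor_cat s s' t t' :
    tensor_rel s s' -> tensor_rel t t' -> tensor_rel (s ++ t) (s' ++ t')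
| tensor_catC s t : tensor_rel (s ++ t) (t ++ s)
| tensor_addl v w a : tensor_rel [:: (v + w, a)] [:: (v, a); (w, a)]
| tensor_addr v a b : tensor_rel [:: (v, a + b)] [:: (v, a); (v, b)]
| tensor_scale r v a : tensor_rel [:: (r *: v, a)] [:: (v, iota r * a)]
| tensor_zero a : tensor_rel [:: (0, a)] [::].

Definition tensor_relb (s t : seq (V * L)) : bool := `[< tensor_rel s t >].

Fact tensor_rel_equiv : equiv_class_of tensor_relb.
Proof.
split=> [s|s t|t s u]; first by apply/asboolP; exact: tensor_refl.
  by apply/idP/idP => /asboolP st; apply/asboolP; exact: tensor_sym.
by move=> /asboolP st /asboolP tu; apply/asboolP; exact: tensor_trans tu.
Qed.

Canonical tensor_equiv := EquivRelPack tensor_rel_equiv.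

Definition tensor : Type := {eq_quot tensor_equiv}.
HB.instance Definition _ := Choice.on tensor.
HB.instance Definition _ := EqQuotient.on tensor.

Fact tensor_piP s t : tensor_rel s t -> \pi_tensor s = \pi_tensor t.
Proof. by move=> st; apply/eqmodP/asboolP. Qed.

Fact tensor_reprP s : tensor_rel (repr (\pi_tensor s)) s.
Proof. by apply/asboolP; have /eqmodP := reprK (\pi_tensor s). Qed.

Definition formal_scale (b : L) (s : seq (V * L)) : seq (V * L) :=
  [seq (p.1, b * p.2) | p <- s].

Fact formal_scale_rel b s t :
  tensor_rel s t -> tensor_rel (formal_scale b s) (formal_scale b t).
Proof.
elim=> {s t} [s|s t _ IH|t s u _ IHst _ IHtu|s s' t t' _ IHs _ IHt|s t|v w a
  |v a c|r v a|a]; rewrite /formal_scale /= ?map_cat ?mulrDr ?[b * (_ * _)]mulrCA.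
- exact: tensor_refl.
- exact: tensor_sym.
- exact: tensor_trans IHtu.
- exact: tensor_cat.
- exact: tensor_catC.
- exact: tensor_addl.
- exact: tensor_addr.
- exact: tensor_scale.
- exact: tensor_zero.
Qed.

Definition tensor_add (x y : tensor) : tensor := \pi_tensor (repr x ++ repr y).
Definition tensor_scal (b : L) (x : tensor) : tensor :=
  \pi_tensor (formal_scale b (repr x)).
Definition tensor_opp (x : tensor) : tensor := tensor_scal (-1) x.

Fact tensor_pi_add s t :
  tensor_add (\pi_tensor s) (\pi_tensor t) = \pi_tensor (s ++ t).
Proof. by apply: tensor_piP; apply: tensor_cat; exact: tensor_reprP. Qed.

Fact tensor_pi_scal b s :
  tensor_scal b (\pi_tensor s) = \pi_tensor (formal_scale b s).
Proof. by apply: tensor_piP; apply: formal_scale_rel; exact: tensor_reprP. Qed.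

Fact tensor_pure0 (v : V) : \pi_tensor [:: (v, 0)] = \pi_tensor [::].
Proof.
apply: tensor_piP; apply: tensor_trans (tensor_zero 0).
by have /tensor_sym := tensor_scale 0 v 0; rewrite scale0r rmorph0 mul0r.
Qed.

Fact tensorP (x : tensor) : exists s, x = \pi_tensor s.
Proof. by exists (repr x); rewrite reprK. Qed.

Fact tensor_addA : associative tensor_add.
Proof.
by move=> x y z; have [x0 ->] := tensorP x;
  have [y0 ->] := tensorP y; have [z0 ->] := tensorP z;
  rewrite !tensor_pi_add catA.
Qed.

Fact tensor_addC : commutative tensor_add.
Proof.
move=> x y; have [x0 ->] := tensorP x; have [y0 ->] := tensorP y;
  rewrite !tensor_pi_add.
by apply: tensor_piP; exact: tensor_catC.
Qed.

Fact tensor_add0 : left_id (\pi_tensor [::]) tensor_add.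
Proof. by move=> x; have [x0 ->] := tensorP x; rewrite tensor_pi_add. Qed.

Fact tensor_scaleDl x : {morph tensor_scal^~ x : a b / a + b >-> tensor_add a b}.
Proof.
move=> a b; have [x0 ->] := tensorP x; rewrite !tensor_pi_scal tensor_pi_add.
elim: x0 => [//|[v c] s IHs]; rewrite /formal_scale /= -/(formal_scale _ s).
rewrite -[_ :: _ ++ _]/([:: _] ++ (formal_scale a s ++ _)) -cat1s.
rewrite -tensor_pi_add IHs -[_ :: formal_scale b s]cat1s.
rewrite mulrDl (tensor_piP (tensor_addr v (a * c) (b * c))).
rewrite -[[:: (v, a * c); _]]cat1s -!tensor_pi_add -!tensor_addA.
by congr tensor_add; rewrite tensor_addA [X in tensor_add X _]tensor_addC tensor_addA.
Qed.

Fact tensor_scale0 x : tensor_scal 0 x = \pi_tensor [::].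
Proof.
have [x0 ->] := tensorP x; rewrite tensor_pi_scal.
elim: x0 => [//|[v c] s IHs]; rewrite /formal_scale /= -/(formal_scale _ s).
by rewrite -cat1s -tensor_pi_add IHs mul0r tensor_pure0 tensor_pi_add.
Qed.

Fact tensor_scale1 : left_id 1 tensor_scal.
Proof.
move=> x; have [x0 ->] := tensorP x;
  rewrite tensor_pi_scal; congr (\pi_tensor _).
by rewrite -[RHS]map_id; apply: eq_map => -[v a] /=; rewrite mul1r.
Qed.

Fact tensor_addN : left_inverse (\pi_tensor [::]) tensor_opp tensor_add.
Proof.
move=> x; rewrite -{2}[x]tensor_scale1 /tensor_opp -tensor_scaleDl addNr.
exact: tensor_scale0.
Qed.

HB.instance Definition _ := GRing.isZmodule.Build tensor
  tensor_addA tensor_addC tensor_add0 tensor_addN.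

Fact tensor_piD s t : \pi_tensor s + \pi_tensor t = \pi_tensor (s ++ t).
Proof. exact: tensor_pi_add. Qed.

Fact tensor_scaleA a b x : tensor_scal a (tensor_scal b x) = tensor_scal (a * b) x.
Proof.
have [x0 ->] := tensorP x; rewrite !tensor_pi_scal; congr (\pi_tensor _).
by rewrite /formal_scale -map_comp; apply: eq_map => p /=; rewrite mulrA.
Qed.

Fact tensor_scaleDr : right_distributive tensor_scal +%R.
Proof.
move=> a x y; have [x0 ->] := tensorP x; have [y0 ->] := tensorP y; 
by rewrite tensor_piD !tensor_pi_scal tensor_piD /formal_scale map_cat.
Qed.

HB.instance Definition _ := GRing.Zmodule_isLmodule.Build L tensor
  tensor_scaleA tensor_scale1 tensor_scaleDr tensor_scaleDl.

Fact tensor_piZ a s : a *: \pi_tensor s = \pi_tensor (formal_scale a s).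
Proof. exact: tensor_pi_scal. Qed.

End Tensor.

Section BaseChangeRep.
Variables (G : groupType) (V : rep R G).

Definition formal_act (g : G) (s : seq (V * L)) : seq (V * L) :=
  [seq (rep_act V g p.1, p.2) | p <- s].

Fact formal_act_rel g s t :
  tensor_rel s t -> tensor_rel (formal_act g s) (formal_act g t).
Proof.
elim=> {s t} [s|s t _ IH|t s u _ IHst _ IHtu|s s' t t' _ IHs _ IHt|s t|v w a
  |v a c|r v a|a]; rewrite /formal_act /= ?map_cat ?linearD ?linearZ ?linear0.
- exact: tensor_refl.
- exact: tensor_sym.
- exact: tensor_trans IHtu.
- exact: tensor_cat.
- exact: tensor_catC.
- exact: tensor_addl.
- exact: tensor_addr.
- exact: tensor_scale.
- exact: tensor_zero.
Qed.

Definition tensor_act (g : G) (x : tensor V) : tensor V :=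
  \pi_(tensor V) (formal_act g (repr x)).

Fact tensor_pi_act g s :
  tensor_act g (\pi_(tensor V) s) = \pi_(tensor V) (formal_act g s).
Proof. by apply: tensor_piP; apply: formal_act_rel; exact: tensor_reprP. Qed.

Fact tensor_act_linear g : linear (tensor_act g).
Proof.
move=> a x y; have [x0 ->] := tensorP x; have [y0 ->] := tensorP y.
rewrite tensor_piZ tensor_piD !tensor_pi_act tensor_piZ tensor_piD; congr (\pi_(tensor V) _).
by rewrite /formal_act map_cat; congr cat; rewrite /formal_scale -!map_comp.
Qed.

HB.instance Definition _ g :=
  GRing.isLinear.Build L (tensor V) (tensor V) _ (tensor_act g)
    (tensor_act_linear g).

Fact tensor_act1 x : tensor_act 1%g x = x.
Proof.
have [x0 ->] := tensorP x; rewrite tensor_pi_act; congr (\pi_(tensor V) _).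
by rewrite -[RHS]map_id; apply: eq_map => -[v a] /=; rewrite rep_act1.
Qed.

Fact tensor_actM g h x : tensor_act (g * h)%g x = tensor_act g (tensor_act h x).
Proof.
have [x0 ->] := tensorP x; rewrite !tensor_pi_act; congr (\pi_(tensor V) _).
by rewrite /formal_act -map_comp; apply: eq_map => p /=; rewrite rep_actM.
Qed.

Definition base_change : rep L G :=
  @Rep L G (tensor V) (fun g => tensor_act g : {linear tensor V -> tensor V})
    tensor_act1 tensor_actM.

End BaseChangeRep.
End BaseChange.

Definition perfect_field (F : fieldType) : Prop :=
  forall p : {poly F}, irreducible_poly p -> separable_poly p.

Definition is_algebraic_closure (R : fieldType) (L : closedFieldType)
    (iota : {rmorphism R -> L}) : Prop :=
  forall x : L, algebraicOver iota x.

Section Galois.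
Variables (R L : fieldType) (iota : {rmorphism R -> L}).

Record galois_aut := GaloisAut {
  gal_fun :> {rmorphism L -> L};
  gal_inv : {rmorphism L -> L};
  gal_funK : cancel gal_fun gal_inv;
  gal_invK : cancel gal_inv gal_fun;
  gal_fix : forall r, gal_fun (iota r) = iota r
}.

Definition galois_id : galois_aut :=
  @GaloisAut idfun idfun (fun => erefl) (fun => erefl) (fun => erefl).

Section Twist.
Variables (G : groupType) (s : galois_aut) (rho : rep L G).

(* The conjugate of rho by s: the same group action on the same additive
   group, with a in L acting as s^-1(a) did. If g e_j = \sum_i a_ij e_i in a
   basis of rho, then g e_j = \sum_i s(a_ij) e_i for the new scalars. *)
Definition twist : Type := rho.
HB.instance Definition _ := GRing.Zmodule.on twist.

Definition twist_scale (a : L) (v : twist) : twist := gal_inv s a *: (v : rho).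

Fact twist_scaleA a b v : twist_scale a (twist_scale b v) = twist_scale (a * b) v.
Proof. by rewrite /twist_scale scalerA rmorphM. Qed.
Fact twist_scale1 : left_id 1 twist_scale.
Proof. by move=> v; rewrite /twist_scale rmorph1 scale1r. Qed.
Fact twist_scaleDr : right_distributive twist_scale +%R.
Proof. by move=> a u v; exact: scalerDr. Qed.
Fact twist_scaleDl v : {morph twist_scale^~ v : a b / a + b}.
Proof. by move=> a b; rewrite /twist_scale rmorphD; exact: scalerDl. Qed.

HB.instance Definition _ := GRing.Zmodule_isLmodule.Build L twist
  twist_scaleA twist_scale1 twist_scaleDr twist_scaleDl.

Definition twist_act (g : G) (v : twist) : twist := rep_act rho g v.

Fact twist_act_linear g : linear (twist_act g).
Proof. by move=> a u v; exact: (linearP (rep_act rho g)). Qed.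

HB.instance Definition _ g :=
  GRing.isLinear.Build L twist twist _ (twist_act g) (twist_act_linear g).

Definition twist_rep : rep L G :=
  @Rep L G twist (fun g => twist_act g : {linear twist -> twist})
    (@rep_act1 _ _ rho) (@rep_actM _ _ rho).

End Twist.

Fact twist_rep_coef (G : groupType) (s : galois_aut) (rho : rep L G) (g : G)
    (n : nat) (e : 'I_n -> rho) (a : 'I_n -> L) (v : rho) :
  rep_act rho g v = \sum_i a i *: e i ->
  rep_act (twist_rep s rho) g v = \sum_i s (a i) *: (e i : twist_rep s rho).
Proof.
move=> gv; rewrite -[LHS]/(rep_act rho g v) gv; apply: eq_bigr => i _.
by rewrite -[RHS]/(gal_inv s (s (a i)) *: (e i : rho)) gal_funK.
Qed.

Section RationalityField.
Variables (G : groupType) (rho : rep L G).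

Definition rat_pred : {pred L} :=
  fun x => `[< forall s : galois_aut, rep_iso (twist_rep s rho) rho -> s x = x >].

Fact rat_pred_divring : divring_closed rat_pred.
Proof.
split=> [|x y|x y]; rewrite ?unfold_in.
- by apply/asboolP => s _; rewrite rmorph1.
- by move=> /asboolP sx /asboolP sy; apply/asboolP => s H; rewrite rmorphB sx ?sy.
- by move=> /asboolP sx /asboolP sy; apply/asboolP => s H;
     rewrite fmorph_div sx ?sy.
Qed.

HB.instance Definition _ :=
  GRing.isDivringClosed.Build L rat_pred rat_pred_divring.

Record rationality_field := RatField {
  rat_val :> L;
  rat_valP : rat_val \in rat_pred
}.

HB.instance Definition _ := [isSub for rat_val].
HB.instance Definition _ := [Choice of rationality_field by <:].
HB.instance Definition _ :=
  [SubChoice_isSubComUnitRing of rationality_field by <:].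
HB.instance Definition _ :=
  [SubComUnitRing_isSubIntegralDomain of rationality_field by <:].
HB.instance Definition _ :=
  [SubIntegralDomain_isSubField of rationality_field by <:].

Fact rat_base_subproof r : iota r \in rat_pred.
Proof. by rewrite unfold_in; apply/asboolP => s _; exact: gal_fix. Qed.

Definition rat_base (r : R) : rationality_field := RatField (rat_base_subproof r).

(* Hom_R (R(rho), L) *)
Record rat_embedding := RatEmbedding {
  rat_emb :> {rmorphism rationality_field -> L};
  rat_emb_base : forall r, rat_emb (rat_base r) = iota r
}.

Definition extends_embedding (w : rat_embedding) (s : galois_aut) : Prop :=
  forall x : rationality_field, s (rat_val x) = w x.

(* Some s extending w; one always exists when L is an algebraic closure of R,
   so that the default value is then never used. *)
Definition embedding_ext (w : rat_embedding) : galois_aut :=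
  if pselect (exists s, extends_embedding w s) is left ex
  then projT1 (cid ex) else galois_id.

Definition conjugate (w : rat_embedding) : rep L G :=
  twist_rep (embedding_ext w) rho.

End RationalityField.
End Galois.

(* Main.v *)
(** Write [M] for [pi1 (x) L].  If [x = sum_i v_i (x) c_i] is a shortest
    nonzero element of a subrepresentation [W] of [M], every element of
    [R[G1]] killing [v_0] kills [x], so [W] contains nonzero vectors fixed by
    any [K] with [pi1^K <> 0].  As [M^K] is finite dimensional, [M] has an
    irreducible subrepresentation; its Galois conjugates span [M] by Galois
    descent, and [rho1] is isomorphic to one of them by the density theorem.
    The stabiliser of [rho1] in the Galois group contains the fixator of a
    finite set, hence is closed, and the conjugates are parametrised by the
    embeddings of the rationality field.  A maximal direct sum of copies of
    [rho1] in [M] and its conjugates then decompose [M].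

    For the second assertion, let [J_w] be the kernel of the map from
    [V (x) L] to its largest [w rho1]-isotypic quotient.  Decomposing [M]
    shows that the intersection of the [J_w] is the base change of the kernel
    of [V -> V_pi1].  For a vector [x] of [V (x) L] fixed by a compact open
    subgroup [K], the density theorem applied to the finite-dimensional spaces
    [(w rho1)^K] gives an element [a] of [L[G1]] with [a x] congruent to [x]
    modulo [J_w0] and to [0] modulo the other [J_w]: the Chinese remainder
    theorem holds. *)
Require Import Defs.
From HB Require Import structures.
From mathcomp Require Import all_boot all_order all_algebra all_field.
From mathcomp Require Import all_classical topology.
(* [gal_inv] of [all_field] would otherwise hide the one of [Defs]. *)
Import Defs.

Set Implicit Arguments.
Unset Strict Implicit.
Unset Printing Implicit Defensive.

Import GRing.Theory.
Local Open Scope classical_set_scope.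
Local Open Scope quotient_scope.
Local Open Scope ring_scope.

(** * Extension of field embeddings *)

(** [V (x) L] is not semisimple in general and [L] may be infinite over [R], so neither idempotents
    nor a finite Galois group are at hand. Elements of the group algebra replace idempotents; each
    is chosen for finitely many vectors, and smoothness and admissibility make finitely many enough.
    Density is proved only in the form [a x_j = chi_j x_j], with scalars that depend on the
    isomorphism class: equivariant maps respect such a prescription whatever the endomorphism rings
    are, so these are never computed. Expressions with fewest terms replace bases. Their two
    families are independent over [R], and a functional from [L] to [R] dual to one coefficient
    induces a map from [V (x) L] to [V] that commutes with the group: this is the way back from [L]
    to [R]. Perfectness enters at one point, to show that an element of [L] fixed by all
    automorphisms comes from [R]. *)

Lemma Zorn_above (T : Type) (P : set (set T)) (S0 : set T) :
  P S0 ->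
  (forall F, F `<=` P -> F !=set0 -> total_on F subset ->
     P (\bigcup_(X in F) X)) ->
  exists A, [/\ S0 `<=` A, P A & forall B, A `<=` B -> P B -> B `<=` A].
Proof.
move=> PS0 Pchain.
(* [Zorn_bigcup] includes the empty chain, whose union is empty; adding [S0] to every set turns that
   case into [P S0]. *)
have [|A [PA maxA]] := @Zorn_bigcup T [set X | P (X `|` S0)].
  move=> F FP Ftot /=.
  have [->|/set0P[X0 FX0]] := eqVneq F set0; first by rewrite bigcup_set0 set0U.
  rewrite (_ : _ `|` _ = \bigcup_(X in [set X `|` S0 | X in F]) X).
    apply: Pchain; first by move=> _ [X FX <-]; exact: FP.
      by exists (X0 `|` S0), X0.
    move=> _ _ [X FX <-] [Y FY <-].
    by have [XY|YX] := Ftot _ _ FX FY; [left|right]; exact: setSU.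
  rewrite eqEsubset; split=> [x [[X FX Xx]|S0x]|x [_ [X FX <-] [Xx|S0x]]].
  - by exists (X `|` S0); [exists X|left].
  - by exists (X0 `|` S0); [exists X0|right].
  - by left; exists X.
  - by right.
exists (A `|` S0); split=> // B AB PB.
apply: contrapT => nBA; have /maxA : A `<` B; last first.
  by apply; rewrite /= (_ : B `|` S0 = B) //; apply/setUidPl => x Sx; apply: AB; right.
split; first by move=> x Ax; apply: AB; left.
by move=> BA; apply: nBA => x /BA; left.
Qed.

Section PartialHom.
Variables (R : fieldType) (L : closedFieldType) (iota : {rmorphism R -> L}).

(* Partial R-algebra homomorphisms L -> L, encoded by their graphs: the
   subrings of L x L that contain the diagonal copy of R and meet 0 x L
   trivially. *)
Record partial_hom (G : set (L * L)) : Prop := PartialHom {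
  partial_homB : forall x y, G x -> G y -> G (x - y);
  partial_homM : forall x y, G x -> G y -> G (x * y);
  partial_hom_base : forall r, G (iota r, iota r);
  partial_hom_inj : forall b, G (0, b) -> b = 0
}.

Definition poly_in (G : set (L * L)) (P : {poly L * L}) := forall i, G P`_i.

Section Closure.
Variables (G : set (L * L)) (G_hom : partial_hom G).

Lemma partial_hom0 : G 0.
Proof. by have := partial_hom_base G_hom 0; rewrite !rmorph0. Qed.

Lemma partial_hom1 : G 1.
Proof. by have := partial_hom_base G_hom 1; rewrite !rmorph1. Qed.

Lemma partial_homD x y : G x -> G y -> G (x + y).
Proof.
move=> Gx Gy; rewrite -[y]opprK; apply: partial_homB => //.
by rewrite -sub0r; apply: partial_homB => //; exact: partial_hom0.
Qed.

Lemma partial_hom_eq x y : G x -> G y -> x.1 = y.1 -> x = y.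
Proof.
case: x y => [a b] [a' b'] Gx Gy /= aa'; subst a'; congr (_, _).
apply/eqP; rewrite -subr_eq0; apply/eqP/(partial_hom_inj G_hom).
by have := partial_homB G_hom Gx Gy; rewrite -[_ - _]/(a - a, b - b') subrr.
Qed.

Lemma poly_inB P Q : poly_in G P -> poly_in G Q -> poly_in G (P - Q).
Proof. by move=> GP GQ i; rewrite coefB; apply: partial_homB. Qed.

Lemma poly_inM P Q : poly_in G P -> poly_in G Q -> poly_in G (P * Q).
Proof.
move=> GP GQ i; rewrite coefM; apply: big_ind => [||j _].
- exact: partial_hom0.
- exact: partial_homD.
- exact: partial_homM.
Qed.

Lemma poly_inC c : G c -> poly_in G c%:P.
Proof. by move=> Gc i; rewrite coefC; case: ifP => // _; exact: partial_hom0. Qed.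

Lemma poly_inXn n : poly_in G 'X^n.
Proof.
move=> i; rewrite coefXn.
by case: eqP => _; [exact: partial_hom1|exact: partial_hom0].
Qed.

End Closure.

Lemma partial_hom_bigcup (F : set (set (L * L))) :
  F `<=` partial_hom -> F !=set0 -> total_on F subset ->
  partial_hom (\bigcup_(X in F) X).
Proof.
move=> FP [X0 FX0] Ftot.
have common X Y x y : F X -> F Y -> X x -> Y y -> exists2 Z, F Z & Z x /\ Z y.
  move=> FX FY Xx Yy; have [XY|YX] := Ftot _ _ FX FY.
    by exists Y => //; split=> //; exact: XY.
  by exists X => //; split=> //; exact: YX.
split.
- move=> x y [X FX Xx] [Y FY Yy]; have [Z FZ [Zx Zy]] := common _ _ _ _ FX FY Xx Yy.
  by exists Z => //; apply: partial_homB => //; exact: FP.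
- move=> x y [X FX Xx] [Y FY Yy]; have [Z FZ [Zx Zy]] := common _ _ _ _ FX FY Xx Yy.
  by exists Z => //; apply: partial_homM => //; exact: FP.
- by move=> r; exists X0 => //; apply: partial_hom_base; exact: FP.
- by move=> b [X FX Xb]; exact: (partial_hom_inj (FP _ FX) Xb).
Qed.

Hypothesis L_alg : forall x : L, algebraicOver iota x.

Definition diag (r : R) : L * L := (iota r, iota r).
Fact diag_zmod : zmod_morphism diag.
Proof. by move=> x y; rewrite /diag !rmorphB. Qed.
Fact diag_monoid : monoid_morphism diag.
Proof. by split=> [|x y]; rewrite /diag ?rmorph1 // !rmorphM. Qed.
HB.instance Definition _ := GRing.isZmodMorphism.Build R (L * L)%type diag diag_zmod.
HB.instance Definition _ := GRing.isMonoidMorphism.Build R (L * L)%type diag diag_monoid.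

Lemma fst_horner (P : {poly L * L}) z : P.[z].1 = (map_poly fst P).[z.1].
Proof. by rewrite horner_map. Qed.
Lemma snd_horner (P : {poly L * L}) z : P.[z].2 = (map_poly snd P).[z.2].
Proof. by rewrite horner_map. Qed.

Lemma diag_horner (p : {poly R}) z :
  (map_poly diag p).[z] = ((map_poly iota p).[z.1], (map_poly iota p).[z.2]).
Proof.
rewrite [LHS]surjective_pairing fst_horner snd_horner -!map_poly_comp.
by congr (_, _).
Qed.

Lemma poly_in_diag G (p : {poly R}) : partial_hom G -> poly_in G (map_poly diag p).
Proof. by move=> GH i; rewrite coef_map; exact: (partial_hom_base GH). Qed.

Lemma poly_in_horner G P z : partial_hom G -> poly_in G P -> G z -> G P.[z].
Proof.
move=> GH GP Gz; rewrite horner_coef; apply: big_ind => [||i _].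
- exact: partial_hom0.
- exact: partial_homD.
apply: partial_homM => //; elim: (nat_of_ord i) => [|n IHn]; first exact: partial_hom1.
by rewrite exprS; exact: partial_homM.
Qed.

(** A ring of algebraic elements is a field: stripped of powers of ['X], a polynomial killing [z.1]
    has a nonzero constant term [c], and solving for [c] gives the inverse. First coordinates
    determine elements of [G], so only these are compared. *)
Lemma partial_homV G z : partial_hom G -> G z -> z.1 != 0 ->
  exists2 t, G t & z * t = 1.
Proof.
move=> GH Gz z1.
have [p p0 pz] := L_alg z.1.
have [m [q]] := multiplicity_XsubC p 0; rewrite p0 /= => q0 pE.
have qz : (map_poly iota q).[z.1] = 0.
  move: pz; rewrite pE subr0 rmorphM rmorphXn /= map_polyX rootM => /orP[/rootP //|].
  by rewrite rootE hornerXn expf_eq0 (negbTE z1) andbF.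
elim/poly_ind: q q0 qz {pE} => [|q c _]; first by rewrite root0.
rewrite rootE hornerMXaddC mulr0 add0r => c0 qz.
have cz : (map_poly iota q).[z.1] * z.1 = - iota c.
  move: qz; rewrite rmorphD rmorphM /= map_polyX map_polyC hornerMXaddC.
  by move/eqP; rewrite addr_eq0 => /eqP.
exists (diag (- c^-1) * (map_poly diag q).[z]).
  apply: partial_homM => //; first exact: (partial_hom_base GH).
  by apply: poly_in_horner => //; exact: poly_in_diag.
apply: (partial_hom_eq GH).
- apply: partial_homM => //; apply: partial_homM => //; first exact: (partial_hom_base GH).
  by apply: poly_in_horner => //; exact: poly_in_diag.
- exact: partial_hom1.
rewrite diag_horner /= mulrCA [z.1 * _]mulrC cz -rmorphN -rmorphM mulrNN mulVf //.
exact: rmorph1.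
Qed.

(** Simple extension: [x] is sent to a root [y] of the image of its minimal polynomial [P] over the
    domain of [G]. The coefficient ring [L * L] has zero divisors, so [P] is made monic by
    [partial_homV] and division is done by hand. *)
Lemma partial_hom_extend G x : partial_hom G ->
  exists2 G', partial_hom G' & G `<=` G' /\ exists y, G' (x, y).
Proof.
move=> GH.
pose vanish n := `[< exists P, [/\ poly_in G P, P != 0, (map_poly fst P).[x] = 0
  & size P = n] >].
have ex_vanish : exists n, vanish n.
  have [p p0 px] := L_alg x; exists (size (map_poly diag p)); apply/asboolP.
  exists (map_poly diag p); split=> //; first exact: poly_in_diag.
    by rewrite map_poly_eq0.
  by rewrite -map_poly_comp; apply/rootP.
case: (ex_minnP ex_vanish) => n /asboolP[P0 [GP0 P00 P0x sP0]] min_n.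
have small Q : poly_in G Q -> (map_poly fst Q).[x] = 0 -> (size Q < n)%N -> Q = 0.
  move=> GQ Qx; case: (eqVneq Q 0) => // Q0; rewrite ltnNge min_n //.
  by apply/asboolP; exists Q.
have [|t Gt tE] := @partial_homV G (lead_coef P0) GH (GP0 _).
  apply: contra_neq P00 => l0; apply/eqP; rewrite -lead_coef_eq0; apply/eqP.
  by apply: (partial_hom_eq GH); [exact: GP0|exact: partial_hom0|].
pose P := P0 * t%:P.
have GP : poly_in G P by apply: poly_inM => //; exact: poly_inC.
have Px : (map_poly fst P).[x] = 0 by rewrite rmorphM hornerM P0x mul0r.
have lP : lead_coef P = 1.
  by rewrite /P lead_coef_proper_mul lead_coefC ?tE ?oner_eq0.
have monP : P \is monic by rewrite monicE lP.
have sP : size P = n.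
  rewrite size_proper_mul ?lead_coefC ?tE ?oner_eq0 // sP0 size_polyC.
  have t0 : t != 0 by apply: contraTneq (oner_neq0 (L * L)%type) => t0; rewrite -tE t0 mulr0 eqxx.
  by rewrite t0 addn1.
(* A monic [P] of size 1 would be the constant 1, which does not vanish at [x]. *)
have [|y] := closed_rootP (map_poly snd P) _.
  apply/eqP => s1.
  have : size P = 1 by rewrite -s1 size_map_poly_id0 // lP /= oner_neq0.
  move=> sP1; have PE : P = 1.
    by rewrite [P]size1_polyC ?sP1 //; rewrite lead_coefE sP1 in lP; rewrite lP.
  move: Px; rewrite PE rmorph1 hornerC => /eqP.
  by rewrite oner_eq0.
move=> /rootP Py.
have Pxy : P.[(x, y)] = 0.
  by rewrite [LHS]surjective_pairing fst_horner snd_horner /= Px Py.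
(* Division by [P], one leading term at a time: [Q - T] still vanishes at [x] and is shorter, until
   the minimality of [n] applies. *)
have key : forall Q, poly_in G Q -> (map_poly fst Q).[x] = 0 -> Q.[(x, y)] = 0.
  move=> Q; have [m] := ubnP (size Q); elim: m Q => // m IHm Q sQ GQ Qx.
  have [sQn|nsQ] := ltnP (size Q) n; first by rewrite (small Q) // horner0.
  have Q0 : Q != 0.
    by apply: contraTneq nsQ => ->; rewrite size_poly0 -ltnNge -sP size_poly_gt0 monic_neq0.
  pose T := (lead_coef Q)%:P * 'X^(size Q - n) * P.
  have GT : poly_in G T.
    do 2?apply: poly_inM => //; last exact: poly_inXn.
    by apply: poly_inC => //; exact: GQ.
  have Txy : T.[(x, y)] = 0 by rewrite hornerM Pxy mulr0.
  have lT : lead_coef T = lead_coef Q.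
    by rewrite lead_coef_Mmonic // lead_coef_Mmonic ?monicXn // lead_coefC.
  have sT : size T = size Q.
    rewrite size_Mmonic // ?sP;
      last by rewrite -lead_coef_eq0 lead_coef_Mmonic ?monicXn // lead_coefC lead_coef_eq0.
    rewrite size_Mmonic ?monicXn ?polyC_eq0 ?lead_coef_eq0 // size_polyXn size_polyC lead_coef_eq0 Q0.
    by rewrite add1n /= subnK.
  rewrite -[Q](subrK T) hornerD Txy addr0; apply: IHm.
  - rewrite -ltnS; apply: leq_trans sQ; rewrite ltnS.
    have s0 : (0 < size Q)%N by rewrite size_poly_gt0.
    rewrite -(ltn_predK s0) ltnS; apply/leq_sizeP => j; rewrite leq_eqVlt.
    case/orP => [/eqP <-|jQ].
      by rewrite coefB -{2}sT -!lead_coefE lT subrr.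
    by apply: nth_default; rewrite (leq_trans (size_polyD _ _)) // size_polyN sT maxnn -(ltn_predK s0).
  - exact: poly_inB.
  - by rewrite rmorphB hornerD hornerN Qx -[(map_poly fst T).[x]](fst_horner T (x, y)) Txy subrr.
exists [set z | exists2 Q, poly_in G Q & z = Q.[(x, y)]].
  split.
  - move=> _ _ [P1 GP1 ->] [P2 GP2 ->]; exists (P1 - P2); first exact: poly_inB.
    by rewrite hornerD hornerN.
  - move=> _ _ [P1 GP1 ->] [P2 GP2 ->]; exists (P1 * P2); first exact: poly_inM.
    by rewrite hornerM.
  - move=> r; exists (diag r)%:P; last by rewrite hornerC.
    by apply: poly_inC => //; exact: (partial_hom_base GH).
  - move=> b [Q GQ Qb]; have : Q.[(x, y)] = 0.
      by apply: key => //; rewrite -(fst_horner Q (x, y)) -Qb.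
    by rewrite -Qb => /(congr1 snd).
split; first by move=> z Gz; exists z%:P; [exact: poly_inC|rewrite hornerC].
exists y, 'X; last by rewrite hornerX.
by rewrite -['X]expr1; exact: poly_inXn.
Qed.

Lemma partial_hom_total G : partial_hom G ->
  exists f : {rmorphism L -> L}, forall z, G z -> f z.1 = z.2.
Proof.
move=> GH.
have [|A [GA AH maxA]] := @Zorn_above _ partial_hom G GH.
  by move=> F; exact: partial_hom_bigcup.
have tot x : exists y, A (x, y).
  have [G' G'H [AG' [y G'y]]] := partial_hom_extend x AH.
  by exists y; apply: maxA G'y.
have [f fA] := choice tot.
have fE x y : A (x, y) -> f x = y.
  by move=> Axy; have /(congr1 snd) := partial_hom_eq AH (fA x) Axy erefl.
have f_zmod : zmod_morphism f by move=> x y; apply: fE; exact: (partial_homB AH (fA x) (fA y)).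
have f_monoid : monoid_morphism f.
  split; first by apply: fE; exact: partial_hom1.
  by move=> x y; apply: fE; exact: (partial_homM AH (fA x) (fA y)).
pose aM := GRing.isZmodMorphism.Build L L f f_zmod.
pose mM := GRing.isMonoidMorphism.Build L L f f_monoid.
pose fm : {rmorphism L -> L} := HB.pack f aM mM.
by exists fm => -[x y] /GA /fE.
Qed.

(** Each [y] is a root of a nonzero polynomial over [R]; [f] maps the finite set of its roots
    injectively into itself, hence onto. *)
Lemma alg_endo_bij (f : {rmorphism L -> L}) :
  (forall r, f (iota r) = iota r) -> exists s : galois_aut iota, gal_fun s = f.
Proof.
move=> f_base.
have surj y : exists x, f x = y.
  have [p p0 py] := L_alg y.
  have [rs pE] := closed_field_poly_normal (map_poly iota p).
  have lp : lead_coef (map_poly iota p) != 0 by rewrite lead_coef_eq0 map_poly_eq0.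
  have rsP x : (x \in undup rs) = root (map_poly iota p) x.
    by rewrite mem_undup pE rootZ // root_prod_XsubC.
  have sub : {subset map f (undup rs) <= undup rs}.
    move=> _ /mapP[x + ->]; rewrite !rsP => px.
    have -> : map_poly iota p = map_poly f (map_poly iota p).
      by rewrite -map_poly_comp; apply: eq_map_poly => r /=; rewrite f_base.
    by rewrite fmorph_root.
  have uq : uniq (map f (undup rs)) by rewrite map_inj_uniq ?undup_uniq //; exact: fmorph_inj.
  have [_ eqf] := uniq_min_size uq sub (eq_leq (esym (size_map _ _))).
  have : y \in undup rs by rewrite rsP.
  by rewrite -eqf => /mapP[x _ ->]; exists x.
have [g fg] := choice surj.
have gf : cancel f g by move=> x; apply: (fmorph_inj f); rewrite fg.
have g_zmod : zmod_morphism g by move=> x y; apply: (fmorph_inj f); rewrite rmorphB !fg.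
have g_monoid : monoid_morphism g.
  by split=> [|x y]; apply: (fmorph_inj f); rewrite ?rmorphM !fg ?rmorph1.
pose aM := GRing.isZmodMorphism.Build L L g g_zmod.
pose mM := GRing.isMonoidMorphism.Build L L g g_monoid.
pose gm : {rmorphism L -> L} := HB.pack g aM mM.
by exists (@GaloisAut R L iota f gm gf fg f_base).
Qed.

Lemma partial_hom_aut G : partial_hom G ->
  exists s : galois_aut iota, forall z, G z -> s z.1 = z.2.
Proof.
move=> GH; have [f fG] := partial_hom_total GH.
have [|s sf] := @alg_endo_bij f; first by move=> r; exact: (fG _ (partial_hom_base GH r)).
by exists s => z Gz; rewrite sf fG.
Qed.

Lemma ex_extends_embedding (G : groupType) (rho : rep L G)
  (w : rat_embedding iota rho) : exists s, extends_embedding w s.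
Proof.
have [|s sw] :=
    @partial_hom_aut [set z | exists x : rationality_field iota rho, z = (rat_val x, w x)].
  split.
  - move=> _ _ [x ->] [y ->]; exists (x - y).
    by rewrite rmorphB.
  - move=> _ _ [x ->] [y ->]; exists (x * y).
    by rewrite rmorphM.
  - by move=> r; exists (rat_base iota rho r); rewrite rat_emb_base.
  - move=> b [x [x0 ->]]; have -> : x = 0 by apply: val_inj.
    exact: rmorph0.
by exists s => x; exact: (sw (rat_val x, w x) (ex_intro _ x erefl)).
Qed.

Lemma embedding_extP (G : groupType) (rho : rep L G)
  (w : rat_embedding iota rho) : extends_embedding w (embedding_ext w).
Proof.
rewrite /embedding_ext; case: pselect => [ex|[]]; last exact: ex_extends_embedding.
exact: projT2 (cid ex).
Qed.

Hypothesis R_perfect : perfect_field R.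

(** Each root of the minimal polynomial [p] of [x] is the image of [x] under an automorphism, so [x]
    is its only root; [p] is separable by perfectness, hence linear. *)
Lemma gal_fixed_base x : (forall s : galois_aut iota, s x = x) -> exists r, x = iota r.
Proof.
move=> fixx.
pose vanish n := `[< exists p, [/\ p != 0, root (map_poly iota p) x & size p = n] >].
have ex_vanish : exists n, vanish n.
  by have [p p0 px] := L_alg x; exists (size p); apply/asboolP; exists p.
case: (ex_minnP ex_vanish) => n /asboolP[p [p0 px sp]] min_n.
have small q : root (map_poly iota q) x -> (size q < n)%N -> q = 0.
  move=> qx; case: (eqVneq q 0) => // q0; rewrite ltnNge min_n //.
  by apply/asboolP; exists q.
have dvd q : root (map_poly iota q) x -> p %| q.
  move=> qx; rewrite /dvdp; apply/eqP; apply: small; last by rewrite -sp ltn_modp.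
  have /(congr1 (fun t => (map_poly iota t).[x])) := divp_eq q p.
  by rewrite rmorphD rmorphM hornerD hornerM (rootP px) (rootP qx) mulr0 add0r rootE => <-.
have size_map q : size (map_poly iota q) = size q by rewrite size_map_poly.
have p_irr : irreducible_poly p.
  split; first by rewrite -(size_map p); apply: root_size_gt1 px; rewrite map_poly_eq0.
  move=> q q1 /dvdpP[r pE].
  have [r0 q0] : r != 0 /\ q != 0.
    by move: p0; rewrite pE mulf_eq0 negb_or => /andP[].
  move: (px); rewrite pE rmorphM rootM => /orP[rx|qx].
    have : (size p <= size r)%N by rewrite sp min_n //; apply/asboolP; exists r.
    rewrite pE size_mul //; have sq : (0 < size q)%N by rewrite size_poly_gt0.
    by case: (size q) sq q1 => [//|[|k]] _ // _; rewrite !addnS /= ltnNge leq_addr.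
  by rewrite -pE /eqp dvd // andbT pE dvdp_mull.
have [rs pE] := closed_field_poly_normal (map_poly iota p).
have rsx y : y \in rs -> y = x.
  move=> yrs; have py : root (map_poly iota p) y.
    by rewrite pE rootZ ?root_prod_XsubC // lead_coef_eq0 map_poly_eq0.
  (* The graph of [q(x) |-> q(y)]: a [q] that vanishes at [x] is a multiple of [p], hence vanishes
     at [y]. *)
  have [|s sG] := @partial_hom_aut [set z | exists q : {poly R}, z = (map_poly diag q).[(x, y)]].
    split.
    - by move=> _ _ [q ->] [r ->]; exists (q - r); rewrite rmorphB hornerD hornerN.
    - by move=> _ _ [q ->] [r ->]; exists (q * r); rewrite rmorphM hornerM.
    - by move=> r; exists r%:P; rewrite map_polyC hornerC.
    - move=> b [q]; rewrite diag_horner /= => -[/esym/rootP/dvd/dvdpP[r ->] ->].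
      by rewrite rmorphM hornerM (rootP py) mulr0.
  have := sG (x, y); rewrite /= fixx => -> //; exists 'X.
  by rewrite map_polyX hornerX.
have rs_uniq : uniq rs.
  rewrite -separable_prod_XsubC.
  have := R_perfect p_irr; rewrite -(separable_map iota) pE; apply: dvdp_separable.
  by rewrite dvdpZr ?dvdpp // lead_coef_eq0 map_poly_eq0.
have rsE : rs = [:: x].
  have srs : (1 < (size rs).+1)%N.
    rewrite -[(size rs).+1](size_prod_XsubC rs id) -(@size_scale _ (lead_coef (map_poly iota p))) -?pE.
      by rewrite size_map; case: p_irr.
    by rewrite lead_coef_eq0 map_poly_eq0.
  case: rs srs rsx rs_uniq {pE} => [//|y [|z rs]] _ rsx.
    by rewrite (rsx y) ?mem_head.
  rewrite (rsx y) ?mem_head // (rsx z) ?inE ?eqxx ?orbT //.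
  by rewrite /= mem_head.
move: pE; rewrite rsE big_seq1 lead_coef_map => /(congr1 (fun q : {poly L} => q`_0)).
rewrite coef_map coefZ coefB coefX coefC sub0r /= mulrN => pE.
exists (- (p`_0 / lead_coef p)).
rewrite rmorphN fmorph_div pE mulNr opprK mulrC mulKf //.
by rewrite fmorph_eq0 lead_coef_eq0.
Qed.

End PartialHom.

(** * The Galois group *)

Section GaloisGroup.
Variables (R L : fieldType) (iota : {rmorphism R -> L}).
Implicit Types s t : galois_aut iota.

Fact galois_inv_fix s r : gal_inv s (iota r) = iota r.
Proof. by rewrite -{1}(gal_fix s r) gal_funK. Qed.

Definition galois_inv s : galois_aut iota :=
  GaloisAut (gal_invK s) (gal_funK s) (galois_inv_fix s).

Fact galois_comp_funK s t : cancel (s \o t) (gal_inv t \o gal_inv s).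
Proof. by move=> x /=; rewrite !gal_funK. Qed.
Fact galois_comp_invK s t : cancel (gal_inv t \o gal_inv s) (s \o t).
Proof. by move=> x /=; rewrite !gal_invK. Qed.
Fact galois_comp_fix s t r : (s \o t) (iota r) = iota r.
Proof. by rewrite /= !gal_fix. Qed.

Definition galois_comp s t : galois_aut iota :=
  @GaloisAut R L iota (s \o t : {rmorphism L -> L})
    (gal_inv t \o gal_inv s : {rmorphism L -> L}) (galois_comp_funK s t) (galois_comp_invK s t)
    (galois_comp_fix s t).

End GaloisGroup.

Section GaloisClosure.
Variables (R : fieldType) (L : closedFieldType) (iota : {rmorphism R -> L}).
Hypothesis L_alg : forall x : L, algebraicOver iota x.
Implicit Types s t : galois_aut iota.

Lemma gal_conjugates x : exists C : seq L, forall s, s x \in C.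
Proof.
have [p p0 px] := L_alg x.
have [rs pE] := closed_field_poly_normal (map_poly iota p).
exists rs => s; rewrite -root_prod_XsubC.
rewrite -(@rootZ _ _ (lead_coef (map_poly iota p))) ?lead_coef_eq0 ?map_poly_eq0 // -pE.
have -> : map_poly iota p = map_poly s (map_poly iota p).
  by rewrite -map_poly_comp; apply: eq_map_poly => r /=; rewrite gal_fix.
by rewrite fmorph_root.
Qed.

Lemma gal_conjugates_seq (cs : seq L) :
  exists O : seq (seq L), forall s, map s cs \in O.
Proof.
elim: cs => [|c cs [O OP]]; first by exists [:: [::]].
have [C CP] := gal_conjugates c.
exists [seq a :: l | a <- C, l <- O] => s /=.
by apply: allpairs_f.
Qed.

(* The product of the X - q, for q in the H-orbit of the polynomial p with
   coefficients cs, has its coefficients fixed by H, hence by t; so t permutes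
   its roots. *)
Lemma gal_closure (H : set (galois_aut iota)) (cs : seq L) t :
  H (galois_id iota) -> (forall s s', H s -> H s' -> H (galois_comp s s')) ->
  (forall x, (forall s, H s -> s x = x) -> t x = x) ->
  exists2 s, H s & forall c, c \in cs -> t c = s c.
Proof.
move=> H1 HM tfix; have [O OP] := gal_conjugates_seq cs.
(* Coding the tuple [cs] as one polynomial lets a single [s] agree with [t] on all of it; treated
   separately, each [c] would have its own [s]. *)
pose D := undup [seq Poly l | l <- O & `[<exists2 s, H s & l = map s cs>]].
have DP s : H s -> Poly (map s cs) \in D.
  move=> Hs; rewrite mem_undup; apply/map_f; rewrite mem_filter OP andbT.
  by apply/asboolP; exists s.
have DE q : q \in D -> exists2 s, H s & q = Poly (map s cs).
  rewrite mem_undup => /mapP[l + ->]; rewrite mem_filter => /andP[/asboolP[s Hs ->] _].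
  by exists s.
have map_Poly s l : map_poly s (Poly l) = Poly (map s l).
  apply/polyP => i; rewrite coef_map !coef_Poly /=.
  have [il|li] := ltnP i (size l); first by rewrite (nth_map 0).
  by rewrite !nth_default ?size_map // rmorph0.
pose P := \prod_(q <- D) ('X - q%:P).
have PfixH s : H s -> map_poly (map_poly s) P = P.
  move=> Hs; rewrite /P rmorph_prod /=.
  under eq_bigr => q _ do rewrite rmorphB /= map_polyX map_polyC /=.
  rewrite -(big_map (map_poly s) xpredT (fun q => 'X - q%:P)); apply: perm_big.
  have uD : uniq (map (map_poly s) D).
    rewrite map_inj_uniq ?undup_uniq //.
    by apply: map_inj_poly; [exact: fmorph_inj|exact: rmorph0].
  have sub : {subset map (map_poly s) D <= D}.
    move=> _ /mapP[q /DE[s' Hs' ->] ->]; rewrite map_Poly -map_comp.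
    exact: (DP (galois_comp s s') (HM _ _ Hs Hs')).
  (* Injectivity on the finite list [D] gives surjectivity, which takes the place of inverses in
     [H]. *)
  have [_ eqD] := uniq_min_size uD sub (eq_leq (esym (size_map _ _))).
  by apply: uniq_perm => //; exact: undup_uniq.
have Pfixt : map_poly (map_poly t) P = P.
  apply/polyP => i; apply/polyP => j; rewrite !coef_map /=; apply: tfix => s Hs.
  by rewrite -{2}(PfixH s Hs) !coef_map.
have : root P (Poly (map t cs)).
  rewrite -map_Poly -{1}Pfixt.
  have : root P (Poly cs) by rewrite root_prod_XsubC -{1}[cs]map_id; exact: (DP _ H1).
  by move=> /rootP Pcs; rewrite rootE horner_map Pcs rmorph0.
rewrite root_prod_XsubC => /DE[s Hs ts]; exists s => // c.
move=> /(nthP 0)[i ics <-]; have /(congr1 (fun q : {poly L} => q`_i)) := ts.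
by rewrite !coef_Poly !(nth_map 0).
Qed.

End GaloisClosure.

(** * Linear functionals and tensor products *)

Section Functionals.
Variables (k : fieldType) (E : lmodType k).

Record is_subspace (S : set E) : Prop := IsSubspace {
  subspace0 : S 0;
  subspaceP : forall (a : k) u v, S u -> S v -> S (a *: u + v)
}.

Lemma subspaceZ S (a : k) u : is_subspace S -> S u -> S (a *: u).
Proof. by move=> SH Su; rewrite -[_ *: _]addr0; apply: subspaceP SH _ _ _ Su (subspace0 SH). Qed.

Lemma subspaceB S u v : is_subspace S -> S u -> S v -> S (u - v).
Proof. by move=> SH Su Sv; rewrite addrC -scaleN1r; exact: subspaceP. Qed.

(** A subspace maximal among those that contain [S] and miss [x] is a complement of the line of [x];
    the functional is the coordinate along [x]. *)
Lemma ex_functional (S : set E) (x : E) : is_subspace S -> ~ S x ->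
  exists l : {scalar E}, l x = 1 /\ forall u, S u -> l u = 0.
Proof.
move=> SH Sx.
have [|F FP [T0 FT0] Ftot|A [SA [AH Ax] maxA]] :=
    @Zorn_above _ [set T | is_subspace T /\ ~ T x] S; first by split.
  split; last by move=> [T FT Tx]; have [] := FP _ FT.
  split; first by exists T0 => //; apply: subspace0; have [] := FP _ FT0.
  move=> a u v [T FT Tu] [T' FT' T'v]; have [TT'|T'T] := Ftot _ _ FT FT'.
    by exists T' => //; apply: subspaceP => //; [have [] := FP _ FT'|exact: TT'].
  by exists T => //; apply: subspaceP => //; [have [] := FP _ FT|exact: T'T].
have dec u : exists a, A (u - a *: x).
  have [Au|nAu] := pselect (A u); first by exists 0; rewrite scale0r subr0.
  pose B := [set w + b *: u | w in A & b in [set: k]].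
  have BH : is_subspace B.
    split; first by exists 0; [exact: subspace0|exists 0 => //; rewrite scale0r addr0].
    move=> a _ _ [w Aw [b _ <-]] [w' Aw' [b' _ <-]].
    exists (a *: w + w'); first exact: subspaceP.
    by exists (a * b + b') => //; rewrite scalerDr scalerDl scalerA addrACA.
  have AB : A `<=` B by move=> w Aw; exists w => //; exists 0 => //; rewrite scale0r addr0.
  have [w Aw [b _ xE]] : B x.
    apply: contrapT => nBx; apply: nAu; apply: (maxA B) => //.
    by exists 0; [exact: subspace0|exists 1 => //; rewrite scale1r add0r].
  have b0 : b != 0 by apply: contra_notN Ax => /eqP b0; rewrite -xE b0 scale0r addr0.
  exists b^-1; rewrite -xE scalerDr scalerA mulVf // scale1r opprD addrCA subrr addr0 -scaleN1r.
  by do 2!apply: subspaceZ => //.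
have [l lP] := choice dec.
have lE u a : A (u - a *: x) -> l u = a.
  move=> Aua; apply: contra_notP Ax => /eqP; rewrite -subr_eq0 => la.
  rewrite -[x]scale1r -(mulVf la) -scalerA; apply: subspaceZ => //.
  have -> : (l u - a) *: x = (u - a *: x) - (u - l u *: x).
    by rewrite scalerBl opprB [RHS]addrC subrKA.
  exact: subspaceB.
have l_scal : scalar l.
  move=> a u v; apply: lE.
  have -> : a *: u + v - (a * l u + l v) *: x = a *: (u - l u *: x) + (v - l v *: x).
    by rewrite scalerDl opprD addrACA scalerBr scalerA.
  exact: subspaceP.
pose lM := GRing.isLinear.Build k E k *%R l l_scal.
pose lm : {scalar E} := HB.pack l lM.
exists lm; split=> [|u Su]; apply: lE.
  by rewrite scale1r subrr; exact: subspace0.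
by rewrite scale0r subr0; exact: SA.
Qed.

Lemma span_or_functional (n : nat) (e : 'I_n -> E) (x : E) :
  (exists c : 'I_n -> k, x = \sum_i c i *: e i) \/
  (exists l : {scalar E}, l x = 1 /\ forall i, l (e i) = 0).
Proof.
pose S := [set u | exists c : 'I_n -> k, u = \sum_i c i *: e i].
have [Sx|nSx] := pselect (S x); [by left|right].
have [|l [lx lS]] := @ex_functional S x _ nSx; last first.
  exists l; split=> // i; apply: lS; exists (fun j => (j == i)%:R).
  rewrite (bigD1 i) //= eqxx scale1r big1 ?addr0 // => j /negbTE ->.
  exact: scale0r.
split; first by exists (fun=> 0); rewrite big1 // => i _; rewrite scale0r.
move=> a _ _ [c ->] [d ->]; exists (fun i => a * c i + d i).
rewrite scaler_sumr -big_split; apply: eq_bigr => i _ /=.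
by rewrite scalerDl scalerA.
Qed.

End Functionals.

Section ScalarRestriction.
Variables (R L : fieldType) (iota : {rmorphism R -> L}).

(** [L] as an [R]-vector space; [iota] is recorded in the type so that the scaling can be inferred
    from it. *)
Definition over_base & {rmorphism R -> L} : Type := L.
Local Notation LR := (over_base iota).
HB.instance Definition _ := GRing.Zmodule.on LR.
Definition over_base_scale (r : R) (c : LR) : LR := iota r * (c : L).
Fact over_base_scaleA a b v : over_base_scale a (over_base_scale b v) = over_base_scale (a * b) v.
Proof. by rewrite /over_base_scale rmorphM mulrA. Qed.
Fact over_base_scale1 : left_id 1 over_base_scale.
Proof. by move=> v; rewrite /over_base_scale rmorph1 mul1r. Qed.
Fact over_base_scaleDr : right_distributive over_base_scale +%R.
Proof. by move=> a u v; exact: mulrDr. Qed.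
Fact over_base_scaleDl v : {morph over_base_scale^~ v : a b / a + b}.
Proof. by move=> a b; rewrite /over_base_scale rmorphD; exact: mulrDl. Qed.
HB.instance Definition _ := GRing.Zmodule_isLmodule.Build R LR
  over_base_scaleA over_base_scale1 over_base_scaleDr over_base_scaleDl.

Lemma over_baseZ r (c : LR) : r *: c = iota r * (c : L).
Proof. by []. Qed.

End ScalarRestriction.

Section Tensor.
Variables (R L : fieldType) (iota : {rmorphism R -> L}) (V : lmodType R).
Local Notation VL := (tensor iota V).

Definition pure (v : V) (c : L) : VL := \pi_(tensor iota V) [:: (v, c)].

Lemma pureDl v w c : pure (v + w) c = pure v c + pure w c.
Proof. by rewrite /pure tensor_piD; apply: tensor_piP; exact: tensor_addl. Qed.
Lemma pureDr v c d : pure v (c + d) = pure v c + pure v d.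
Proof. by rewrite /pure tensor_piD; apply: tensor_piP; exact: tensor_addr. Qed.
Lemma pure_scale r v c : pure (r *: v) c = pure v (iota r * c).
Proof. by apply: tensor_piP; exact: tensor_scale. Qed.
Lemma pureZ b v c : b *: pure v c = pure v (b * c).
Proof. by rewrite /pure tensor_piZ. Qed.
Lemma pure0l c : pure 0 c = 0.
Proof. by apply: (addrI (pure 0 c)); rewrite -pureDl !addr0. Qed.
Lemma pure0r v : pure v 0 = 0.
Proof. by apply: (addrI (pure v 0)); rewrite -pureDr !addr0. Qed.
Lemma pure_suml (I : Type) (r : seq I) (F : I -> V) c :
  pure (\sum_(i <- r) F i) c = \sum_(i <- r) pure (F i) c.
Proof. by apply: (big_morph (pure^~ c)); [move=> u v; exact: pureDl|exact: pure0l]. Qed.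
Lemma pure_sumr (I : Type) (r : seq I) (F : I -> L) v :
  pure v (\sum_(i <- r) F i) = \sum_(i <- r) pure v (F i).
Proof. by apply: (big_morph (pure v)); [move=> c d; exact: pureDr|exact: pure0r]. Qed.

Lemma tensor_piE s : \pi_(tensor iota V) s = \sum_(p <- s) pure p.1 p.2.
Proof.
elim: s => [|[v c] s IHs]; first by rewrite big_nil.
by rewrite big_cons -IHs /pure tensor_piD.
Qed.

Lemma pure_sum_repr (x : VL) : x = \sum_(p <- repr x) pure p.1 p.2.
Proof. by rewrite -tensor_piE reprK. Qed.

Lemma pure_sum_ord (x : VL) :
  exists n (v : 'I_n -> V) (c : 'I_n -> L), x = \sum_i pure (v i) (c i).
Proof.
pose s := repr x; exists (size s), (fun i => (nth (0, 0) s i).1), (fun i => (nth (0, 0) s i).2).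
by rewrite {1}[x]pure_sum_repr -/s (big_nth (0, 0)) big_mkord.
Qed.

Section Lift.
Variable M : zmodType.

Record balanced (f : V -> L -> M) : Prop := Balanced {
  balancedDl : forall v w c, f (v + w) c = f v c + f w c;
  balancedDr : forall v c d, f v (c + d) = f v c + f v d;
  balancedZ : forall r v c, f (r *: v) c = f v (iota r * c)
}.

(** With values in a bare abelian group, one universal property serves the [R]-linear [contract],
    the semilinear [gal_act] and the [L]-linear [tensor_map]. *)
Definition tensor_lift f & balanced f := locked (fun x : VL => \sum_(p <- repr x) f p.1 p.2).

Lemma tensor_lift_pi f (fB : balanced f) s :
  tensor_lift fB (\pi_(tensor iota V) s) = \sum_(p <- s) f p.1 p.2.
Proof.
rewrite /tensor_lift -lock; move: (tensor_reprP iota s).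
move: (repr _) => s'; elim=> {s s'} //.
- by move=> s t u _ -> _ ->.
- by move=> s s' t t' _ eqs _ eqt; rewrite !big_cat /= eqs eqt.
- by move=> s t; rewrite !big_cat /= addrC.
- by move=> v w a; rewrite !big_cons !big_nil !addr0 (balancedDl fB).
- by move=> v w a; rewrite !big_cons !big_nil !addr0 (balancedDr fB).
- by move=> v w a; rewrite !big_cons !big_nil !addr0 (balancedZ fB).
- move=> a; rewrite !big_cons !big_nil addr0 /=.
  by apply: (addrI (f 0 a)); rewrite -(balancedDl fB) !addr0.
Qed.

Fact tensor_lift_zmod f (fB : balanced f) : zmod_morphism (tensor_lift fB).
Proof.
have add x y : tensor_lift fB (x + y) = tensor_lift fB x + tensor_lift fB y.
  have [s ->] := tensorP x; have [t ->] := tensorP y.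
  by rewrite tensor_piD !tensor_lift_pi big_cat.
by move=> x y; apply/eqP; rewrite -(inj_eq (addIr (tensor_lift fB y))) -add !subrK.
Qed.

HB.instance Definition _ f (fB : balanced f) :=
  GRing.isZmodMorphism.Build VL M (tensor_lift fB) (tensor_lift_zmod fB).

Lemma tensor_lift_pure f (fB : balanced f) v c : tensor_lift fB (pure v c) = f v c.
Proof. by rewrite tensor_lift_pi big_seq1. Qed.

End Lift.

Fact contract_balanced (l : {scalar (over_base iota)}) :
  balanced (fun (v : V) (c : L) => l c *: v).
Proof.
split=> [v w c|v c d|r v c]; first by rewrite scalerDr.
  by rewrite raddfD scalerDl.
by rewrite scalerA mulrC -linearZ.
Qed.

(** This is [id (x) l]. These maps commute with the action of [R[G]] and are jointly injective as
    [l] varies. *)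
Definition contract l : {additive VL -> V} := tensor_lift (contract_balanced l).

Lemma contract_pure l v c : contract l (pure v c) = l c *: v.
Proof. exact: tensor_lift_pure. Qed.

Fact coefficient_balanced (l : {scalar V}) :
  balanced (fun (v : V) (c : L) => iota (l v) * c).
Proof.
split=> [v w c|v c d|r v c]; first by rewrite raddfD rmorphD mulrDl.
  by rewrite mulrDr.
by rewrite linearZ rmorphM mulrCA mulrA.
Qed.

Definition coefficient l : {additive VL -> L} := tensor_lift (coefficient_balanced l).

Lemma coefficient_pure l v c : coefficient l (pure v c) = iota (l v) * c.
Proof. exact: tensor_lift_pure. Qed.

(** Minimality of the number of terms makes both families linearly independent over [R]; the dual
    functionals below express this. *)
Definition reduced n (v : 'I_n -> V) (c : 'I_n -> L) :=
  forall m (v' : 'I_m -> V) (c' : 'I_m -> L),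
    \sum_i pure (v' i) (c' i) = \sum_i pure (v i) (c i) -> (n <= m)%N.

Lemma ex_reduced (x : VL) : exists n (v : 'I_n -> V) (c : 'I_n -> L),
  x = \sum_i pure (v i) (c i) /\ reduced v c.
Proof.
pose len n := `[< exists (v : 'I_n -> V) (c : 'I_n -> L), x = \sum_i pure (v i) (c i) >].
have ex_len : exists n, len n.
  by have [n [v [c xE]]] := pure_sum_ord x; exists n; apply/asboolP; exists v, c.
case: (ex_minnP ex_len) => n /asboolP[v [c xE]] min_n.
exists n, v, c; split=> // m v' c' eq_x; apply: min_n; apply/asboolP.
by exists v', c'; rewrite eq_x.
Qed.

Lemma sum_lift n (M : zmodType) (i : 'I_n.+1) (F : 'I_n.+1 -> M) :
  \sum_j F j = F i + \sum_(j < n) F (lift i j).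
Proof.
rewrite (bigD1_ord i) //=.
Qed.

(** If [c i] were an [R]-combination of the other [c j], its term could be absorbed into theirs and
    the sum would be shorter. *)
Lemma reduced_functionalr n (v : 'I_n -> V) (c : 'I_n -> L) i : reduced v c ->
  exists l : {scalar (over_base iota)}, forall j, l (c j) = (j == i)%:R.
Proof.
case: n v c i => [|n] v c i; first by case: i.
move=> red.
have [[a ci]|[l [lci lc]]] :=
    @span_or_functional R (over_base iota) n (fun j => c (lift i j)) (c i); last first.
  exists l => j; case: (unliftP i j) => [j' ->|->]; last by rewrite eqxx lci.
  by rewrite lc eq_sym eq_liftF.
suff: (n.+1 <= n)%N by rewrite ltnn.
apply: (red n (fun j => v (lift i j) + a j *: v i) (fun j => c (lift i j))).
rewrite [RHS](sum_lift i) ci pure_sumr -big_split; apply: eq_bigr => j _ /=.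
by rewrite pureDl pure_scale addrC over_baseZ.
Qed.

Lemma reduced_functionall n (v : 'I_n -> V) (c : 'I_n -> L) i : reduced v c ->
  exists l : {scalar V}, forall j, l (v j) = (j == i)%:R.
Proof.
case: n v c i => [|n] v c i; first by case: i.
move=> red.
have [[a vi]|[l [lvi lv]]] :=
    @span_or_functional R V n (fun j => v (lift i j)) (v i); last first.
  exists l => j; case: (unliftP i j) => [j' ->|->]; last by rewrite eqxx lvi.
  by rewrite lv eq_sym eq_liftF.
suff: (n.+1 <= n)%N by rewrite ltnn.
apply: (red n (fun j => v (lift i j)) (fun j => c (lift i j) + iota (a j) * c i)).
rewrite [RHS](sum_lift i) vi pure_suml -big_split; apply: eq_bigr => j _ /=.
by rewrite pureDr pure_scale addrC.
Qed.

Lemma contract_sum (l : {scalar (over_base iota)}) n (v : 'I_n -> V) (c : 'I_n -> L) i :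
  (forall j, l (c j) = (j == i)%:R) -> contract l (\sum_j pure (v j) (c j)) = v i.
Proof.
move=> lc; rewrite raddf_sum (bigD1 i) //= contract_pure lc eqxx scale1r.
by rewrite big1 ?addr0 // => j /negbTE ji; rewrite contract_pure lc ji scale0r.
Qed.

Lemma coefficient_sum (l : {scalar V}) n (v : 'I_n -> V) (c : 'I_n -> L) i :
  (forall j, l (v j) = (j == i)%:R) -> coefficient l (\sum_j pure (v j) (c j)) = c i.
Proof.
move=> lv; rewrite raddf_sum (bigD1 i) //= coefficient_pure lv eqxx rmorph1 mul1r.
by rewrite big1 ?addr0 // => j /negbTE ji; rewrite coefficient_pure lv ji rmorph0 mul0r.
Qed.

Lemma contract_inj (x : VL) : (forall l, contract l x = 0) -> x = 0.
Proof.
move=> x0; have [n [v [c [xE red]]]] := ex_reduced x.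
rewrite xE big1 // => i _; have [l lc] := reduced_functionalr i red.
by rewrite -(contract_sum v lc) -xE x0 pure0l.
Qed.

End Tensor.

(** * Group algebra and density *)

Section GroupAlgebra.
Variables (k : fieldType) (G : groupType).
Implicit Types U W : rep k G.

(* The group algebra k[G], as formal sums. *)
Definition galg := seq (k * G).
Implicit Types a b : galg.

Definition galg_scale (c : k) a : galg := [seq (c * p.1, p.2) | p <- a].
Definition galg_mul (g : G) a : galg := [seq (p.1, (g * p.2)%g) | p <- a].

Definition galg_act U a (u : U) : U := \sum_(p <- a) p.1 *: rep_act U p.2 u.

Fact galg_act_linear U a : linear (galg_act a : U -> U).
Proof.
move=> c u v; rewrite /galg_act scaler_sumr -big_split; apply: eq_bigr => p _ /=.
by rewrite linearP scalerDr !scalerA mulrC.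
Qed.
HB.instance Definition _ U a := GRing.isLinear.Build k U U _ (galg_act a) (@galg_act_linear U a).

Lemma galg_act_sum U a (I : Type) (r : seq I) (F : I -> U) :
  galg_act a (\sum_(i <- r) F i) = \sum_(i <- r) galg_act a (F i).
Proof. exact: linear_sum. Qed.
Lemma galg_act_cat U a b (u : U) : galg_act (a ++ b) u = galg_act a u + galg_act b u.
Proof. by rewrite /galg_act big_cat. Qed.
Lemma galg_act_scale U c a (u : U) : galg_act (galg_scale c a) u = c *: galg_act a u.
Proof.
by rewrite /galg_act big_map scaler_sumr; apply: eq_bigr => p _; rewrite scalerA.
Qed.
Lemma galg_act_mul U g a (u : U) : galg_act (galg_mul g a) u = rep_act U g (galg_act a u).
Proof.
rewrite /galg_act big_map linear_sum; apply: eq_bigr => p _ /=.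
by rewrite linearZ rep_actM.
Qed.
Lemma galg_act_nil U (u : U) : galg_act [::] u = 0.
Proof. exact: big_nil. Qed.
Lemma galg_act1 U g (u : U) : galg_act [:: (1, g)] u = rep_act U g u.
Proof. by rewrite /galg_act big_seq1 scale1r. Qed.

Lemma galg_act_equivariant U W (f : {linear U -> W}) a u :
  equivariant f -> f (galg_act a u) = galg_act a (f u).
Proof.
by move=> fE; rewrite linear_sum; apply: eq_bigr => p _; rewrite linearZ fE.
Qed.

Lemma galg_act_subrep U (N : subrep U) a u :
  subrep_set N u -> subrep_set N (galg_act a u).
Proof.
move=> Nu; apply: big_ind => [||p _]; first exact: subrep0.
  by move=> v w; exact: subrepD.
by apply: subrepZ; exact: subrep_act.
Qed.

Record left_ideal (J : galg -> Prop) : Prop := LeftIdeal {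
  left_ideal0 : J [::];
  left_idealP : forall c a b, J a -> J b -> J (galg_scale c a ++ b);
  left_idealM : forall g a, J a -> J (galg_mul g a)
}.

Section IdealImage.
Variables (U : rep k G) (J : galg -> Prop) (JH : left_ideal J) (u : U).

Definition ideal_image_set : set U := [set v | exists2 a, J a & v = galg_act a u].
Fact ideal_image0 : ideal_image_set 0.
Proof. by exists [::]; rewrite ?galg_act_nil //; exact: left_ideal0. Qed.
Fact ideal_imageP (c : k) v w :
  ideal_image_set v -> ideal_image_set w -> ideal_image_set (c *: v + w).
Proof.
move=> [a Ja ->] [b Jb ->]; exists (galg_scale c a ++ b); first exact: left_idealP.
by rewrite galg_act_cat galg_act_scale.
Qed.
Fact ideal_image_act g v : ideal_image_set v -> ideal_image_set (rep_act U g v).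
Proof.
move=> [a Ja ->]; exists (galg_mul g a); first exact: left_idealM.
by rewrite galg_act_mul.
Qed.
Definition ideal_image : subrep U := Subrep ideal_image0 ideal_imageP ideal_image_act.

End IdealImage.

Fact full_ideal : left_ideal (fun=> True). Proof. by []. Qed.

Definition cyclic_subrep U (u : U) : subrep U := ideal_image full_ideal u.

Lemma cyclic_subrep_id U (u : U) : subrep_set (cyclic_subrep u) u.
Proof. by exists [:: (1, 1%g)]; rewrite ?galg_act1 ?rep_act1. Qed.

Lemma cyclic_subrep_sub U (N : subrep U) u :
  subrep_set N u -> subrep_set (cyclic_subrep u) `<=` subrep_set N.
Proof. by move=> Nu _ [a _ ->]; exact: galg_act_subrep. Qed.

Lemma irreducible_full U (N : subrep U) u :
  irreducible_rep U -> subrep_set N u -> u != 0 -> forall v, subrep_set N v.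
Proof.
move=> [_ irr] Nu u0 v; have [N0|->//] := irr N.
by move: Nu; rewrite N0 /= => /eqP; rewrite (negbTE u0).
Qed.

Lemma irreducible_cyclic U (u v : U) :
  irreducible_rep U -> u != 0 -> exists a, v = galg_act a u.
Proof.
move=> irr u0; have [a _ ->] := irreducible_full irr (cyclic_subrep_id u) u0 v.
by exists a.
Qed.

Section KernelImage.
Variables (U W : rep k G) (f : {linear U -> W}) (fE : equivariant f).

Fact kernel0 : [set u | f u = 0] 0. Proof. exact: linear0. Qed.
Fact kernelP (c : k) u v :
  [set u | f u = 0] u -> [set u | f u = 0] v -> [set u | f u = 0] (c *: u + v).
Proof. by rewrite /= linearP => -> ->; rewrite scaler0 addr0. Qed.
Fact kernel_act g u : [set u | f u = 0] u -> [set u | f u = 0] (rep_act U g u).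
Proof. by rewrite /= fE => ->; rewrite linear0. Qed.
Definition kernel_subrep : subrep U := Subrep kernel0 kernelP kernel_act.

Variable N : subrep U.
Fact image0 : (f @` subrep_set N) 0.
Proof. by exists 0; [exact: subrep0|exact: linear0]. Qed.
Fact imageP (c : k) u v :
  (f @` subrep_set N) u -> (f @` subrep_set N) v -> (f @` subrep_set N) (c *: u + v).
Proof.
by move=> [x Nx <-] [y Ny <-]; exists (c *: x + y); [exact: subrepP|rewrite linearP].
Qed.
Fact image_act g u : (f @` subrep_set N) u -> (f @` subrep_set N) (rep_act W g u).
Proof. by move=> [x Nx <-]; exists (rep_act U g x); [exact: subrep_act|exact: fE]. Qed.
Definition image_subrep : subrep W := Subrep image0 imageP image_act.

End KernelImage.

Definition full_subrep U : subrep U :=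
  @Subrep k G U setT I (fun _ _ _ _ _ => I) (fun _ _ _ => I).

Lemma linear_injective U W (f : {linear U -> W}) :
  (forall u, f u = 0 -> u = 0) -> injective f.
Proof.
move=> f0 u v fuv; apply/eqP; rewrite -subr_eq0; apply/eqP/f0.
by rewrite linearB fuv subrr.
Qed.

Lemma Schur_injective U W (f : {linear U -> W}) (u : U) :
  irreducible_rep U -> equivariant f -> f u != 0 -> injective f.
Proof.
move=> irr fE fu; apply: linear_injective => v fv; apply/eqP.
apply: contraTT fu => v0; rewrite negbK; apply/eqP.
exact: (irreducible_full (N := kernel_subrep fE) irr fv v0).
Qed.

Lemma Schur_surjective U W (f : {linear U -> W}) (u : U) :
  irreducible_rep W -> equivariant f -> f u != 0 -> forall w, exists v, f v = w.
Proof.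
move=> irr fE fu w.
have fuI : (f @` subrep_set (full_subrep U)) (f u) by exists u.
have [v _ <-] := irreducible_full (N := image_subrep fE (full_subrep U)) irr fuI fu w.
by exists v.
Qed.

Lemma rep_iso_bij U W (f : {linear U -> W}) :
  equivariant f -> injective f -> (forall w, exists u, f u = w) -> rep_iso U W.
Proof.
move=> fE finj fsurj; exists f; split=> //.
have [g fg] := choice fsurj; exists g => // u; exact: finj.
Qed.

Lemma Schur_iso U W (f : {linear U -> W}) (u : U) :
  irreducible_rep U -> irreducible_rep W -> equivariant f -> f u != 0 -> rep_iso U W.
Proof.
move=> irrU irrW fE fu; apply: (rep_iso_bij fE); first exact: Schur_injective fu.
exact: Schur_surjective fu.
Qed.

Lemma rep_iso_sym U W : rep_iso U W -> rep_iso W U.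
Proof.
move=> [f [[g fg gf] fE]].
have g_lin : linear g by move=> c u v; apply: (can_inj fg); rewrite linearP !gf.
pose gM := GRing.isLinear.Build k W U _ g g_lin.
pose gl : {linear W -> U} := HB.pack g gM.
exists gl; split; first by exists f.
by move=> h u; apply: (can_inj fg); rewrite /= fE !gf.
Qed.

Lemma rep_iso_trans U W X : rep_iso U W -> rep_iso W X -> rep_iso U X.
Proof.
move=> [f [fb fE]] [g [gb gE]]; exists (g \o f : {linear U -> X}).
by split; [exact: bij_comp|move=> h u /=; rewrite fE gE].
Qed.

Section Density.
Variables (I : Type) (rho : I -> rep k G) (rho_irr : forall i, irreducible_rep (rho i)).
Variables (J : eqType) (idx : J -> I) (x : forall j, rho (idx j)).

Definition annihilates (s : seq J) a := forall j, j \in s -> galg_act a (x j) = 0.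

Lemma annihilator_ideal s : left_ideal (annihilates s).
Proof.
split=> [j _|c a b a0 b0 j js|g a a0 j js]; first exact: galg_act_nil.
  by rewrite galg_act_cat galg_act_scale a0 // b0 // scaler0 addr0.
by rewrite galg_act_mul a0 // linear0.
Qed.

Lemma annihilator_dichotomy s i (y : rho i) :
  (forall a, annihilates s a -> galg_act a y = 0) \/
  (forall z, exists a, annihilates s a /\ galg_act a y = z).
Proof.
have [_ /(_ (ideal_image (annihilator_ideal s) y))[N0|NT]] := rho_irr i; [left|right].
  move=> a sa; have : subrep_set (ideal_image (annihilator_ideal s) y) (galg_act a y) by exists a.
  by rewrite N0.
move=> z; have [a sa ->] : subrep_set (ideal_image (annihilator_ideal s) y) z by rewrite NT.
by exists a.
Qed.

(* By Schur's lemma chi is arbitrary when the representations of the family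
   are pairwise non-isomorphic. *)
Variable chi : I -> k.
Hypothesis chiP : forall i j (f : {linear rho i -> rho j}) u,
  equivariant f -> f u != 0 -> chi i = chi j.

Lemma density_step s i (y : rho i) :
  (forall a, annihilates s a -> galg_act a y = 0) ->
  forall a, (forall j, j \in s -> galg_act a (x j) = chi (idx j) *: x j) ->
    galg_act a y = chi i *: y.
Proof.
elim: s i y => [|j s IHs] i y sy a sa.
  have := sy [:: (1, 1%g)]; rewrite galg_act1 rep_act1 => -> //.
  by rewrite linear0 scaler0.
have sa' j' : j' \in s -> galg_act a (x j') = chi (idx j') *: x j'.
  by move=> j's; apply: sa; rewrite inE j's orbT.
have [sx0|sxT] := annihilator_dichotomy s (x j).
  apply: IHs sa' => b sb; apply: sy => j'; rewrite inE => /predU1P[->|]; last exact: sb.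
  exact: sx0.
have [b bP] := choice sxT.
pose f z := galg_act (b z) y.
have fP c z : annihilates s c -> galg_act c (x j) = z -> f z = galg_act c y.
  move=> sc cz; have [sb bz] := bP z; apply/eqP; rewrite -subr_eq0 -scaleN1r addrC.
  rewrite -galg_act_scale -galg_act_cat; apply/eqP/sy => j'.
  rewrite inE galg_act_cat galg_act_scale => /predU1P[->|j's].
    by rewrite cz bz scaleN1r addNr.
  by rewrite sc // sb // scaler0 addr0.
have f_lin : linear f.
  move=> c u v; have [su ub] := bP u; have [sv vb] := bP v.
  rewrite (fP (galg_scale c (b u) ++ b v)).
  - by rewrite galg_act_cat galg_act_scale.
  - exact: (left_idealP (annihilator_ideal s)).
  - by rewrite galg_act_cat galg_act_scale ub vb.
pose fM := GRing.isLinear.Build k (rho (idx j)) (rho i) _ f f_lin.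
pose fl : {linear rho (idx j) -> rho i} := HB.pack f fM.
have fE : equivariant fl.
  move=> g u; have [su ub] := bP u; rewrite /= (fP (galg_mul g (b u))).
  - by rewrite galg_act_mul.
  - exact: (left_idealM (annihilator_ideal s)).
  - by rewrite galg_act_mul ub.
have yE : galg_act a (y - fl (x j)) = chi i *: (y - fl (x j)).
  apply: (IHs i _ _ a sa') => c sc; rewrite linearB /= -(galg_act_equivariant _ _ fE).
  by rewrite -(fP c _ sc erefl) /= subrr.
have fxE : galg_act a (fl (x j)) = chi i *: fl (x j).
  have [->|fx0] := eqVneq (fl (x j)) 0; first by rewrite linear0 scaler0.
  rewrite -(galg_act_equivariant _ _ fE) sa ?mem_head // linearZ.
  by rewrite (chiP fE fx0).
by rewrite -[y](subrK (fl (x j))) linearD [LHS]/= yE [X in _ + X = _]fxE -scalerDr.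
Qed.

(** Interpolation: either the annihilator of the previous vectors reaches every value at [x j], and
    one of its elements corrects [a], or it kills [x j] and [density_step] shows that [a] is already
    right there. *)
Lemma density_seq (s : seq J) :
  exists a, forall j, j \in s -> galg_act a (x j) = chi (idx j) *: x j.
Proof.
elim: s => [|j s [a sa]]; first by exists [::].
have [sx0|sxT] := annihilator_dichotomy s (x j).
  exists a => j'; rewrite inE => /predU1P[->|]; last exact: sa.
  exact: (density_step sx0 sa).
have [b [sb bx]] := sxT (chi (idx j) *: x j - galg_act a (x j)).
exists (a ++ b) => j'; rewrite inE galg_act_cat => /predU1P[->|j's].
  by rewrite bx addrC subrK.
by rewrite sb // addr0 sa.
Qed.

End Density.

Lemma Jacobson_density (I : Type) (rho : I -> rep k G) (J : finType) (idx : J -> I)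
    (x : forall j, rho (idx j)) (chi : I -> k) :
  (forall i, irreducible_rep (rho i)) ->
  (forall i j (f : {linear rho i -> rho j}) u,
     equivariant f -> f u != 0 -> chi i = chi j) ->
  exists a, forall j, galg_act a (x j) = chi (idx j) *: x j.
Proof.
move=> irr chiP; have [a aP] := density_seq irr x chiP (enum J).
by exists a => j; apply: aP; rewrite mem_enum.
Qed.

Section SubrepAsRep.
Variables (U : rep k G) (N : subrep U).

Definition subrep_pred : {pred U} := fun u => `[<subrep_set N u>].
Fact subrep_pred_submod : submod_closed subrep_pred.
Proof.
split=> [|c u v]; rewrite !unfold_in; first by apply/asboolP; exact: subrep0.
by move=> /asboolP Nu /asboolP Nv; apply/asboolP; exact: subrepP.
Qed.
HB.instance Definition _ := GRing.isSubmodClosed.Build k U subrep_pred subrep_pred_submod.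

Record subrep_mod := SubrepMod { subrep_val : U; subrep_valP : subrep_val \in subrep_pred }.
HB.instance Definition _ := [isSub for subrep_val].
HB.instance Definition _ := [Choice of subrep_mod by <:].
HB.instance Definition _ := [SubChoice_isSubLmodule of subrep_mod by <:].

Fact subrep_mod_act_subproof g (u : subrep_mod) : rep_act U g (val u) \in subrep_pred.
Proof.
by rewrite unfold_in; apply/asboolP/subrep_act/asboolP; exact: (valP u).
Qed.
Definition subrep_mod_act g (u : subrep_mod) := SubrepMod (subrep_mod_act_subproof g u).
Fact subrep_mod_act_linear g : linear (subrep_mod_act g).
Proof. by move=> c u v; apply: val_inj; rewrite /= linearP. Qed.
HB.instance Definition _ g :=
  GRing.isLinear.Build k subrep_mod subrep_mod _ (subrep_mod_act g) (subrep_mod_act_linear g).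
Fact subrep_mod_act1 u : subrep_mod_act 1%g u = u.
Proof. by apply: val_inj; rewrite /= rep_act1. Qed.
Fact subrep_mod_actM g h u : subrep_mod_act (g * h)%g u = subrep_mod_act g (subrep_mod_act h u).
Proof. by apply: val_inj; rewrite /= rep_actM. Qed.
Definition subrep_rep : rep k G :=
  @Rep k G subrep_mod (fun g => subrep_mod_act g : {linear subrep_mod -> subrep_mod})
    subrep_mod_act1 subrep_mod_actM.

Definition subrep_incl : {linear subrep_rep -> U} := (val : subrep_mod -> U).

Lemma subrep_incl_inj : injective subrep_incl. Proof. exact: val_inj. Qed.
Lemma subrep_incl_equivariant : equivariant subrep_incl. Proof. by []. Qed.
Lemma subrep_inclP u : subrep_set N u <-> exists v, subrep_incl v = u.
Proof.
split=> [Nu|[v <-]]; last by apply/asboolP; exact: (valP (v : subrep_mod)).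
by exists (SubrepMod (asboolT Nu : u \in subrep_pred)).
Qed.

End SubrepAsRep.

End GroupAlgebra.

Section QuotientMap.
Variables (k : fieldType) (G : groupType) (U : rep k G) (N : subrep U).

Definition quo_proj (u : U) : quo_rep N := \pi_(quo N) u.
Fact quo_proj_linear : linear quo_proj.
Proof. by move=> a u v; rewrite /quo_proj quo_piZ quo_piD. Qed.
HB.instance Definition _ := GRing.isLinear.Build k U (quo_rep N) _ quo_proj quo_proj_linear.
Lemma quo_proj_equivariant : equivariant quo_proj.
Proof. by move=> g u; rewrite /quo_proj /= quo_pi_act. Qed.
Lemma quo_proj_eq0 u : quo_proj u = 0 <-> subrep_set N u.
Proof.
split=> [/eqmodP/asboolP|Nu]; first by rewrite subr0.
by apply: quo_piP; rewrite subr0.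
Qed.
Lemma quo_proj_repr (x : quo_rep N) : quo_proj (repr (x : quo N)) = x.
Proof. exact: reprK. Qed.

End QuotientMap.

Section Restriction.
Variables (k : fieldType) (G1 G2 : groupType) (U : rep k (G1 * G2)%type).
Fact restrict_act1 u : rep_act U (1, 1)%g u = u.
Proof. exact: rep_act1. Qed.
Fact restrict_actM (g h : G1) u :
  rep_act U ((g * h), 1)%g u = rep_act U (g, 1)%g (rep_act U (h, 1)%g u).
Proof. by rewrite -rep_actM; congr (rep_act U _ u); congr (_, _); rewrite /= mulg1. Qed.
Definition restrict_rep : rep k G1 :=
  @Rep k G1 U (fun g => rep_act U (g, 1%g)) restrict_act1 restrict_actM.
End Restriction.

(** * Subrepresentations of a base change *)

Section LinearIndependence.
Variables (k : fieldType) (E : lmodType k).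

Definition lin_indep n (x : 'I_n -> E) :=
  forall c : 'I_n -> k, \sum_i c i *: x i = 0 -> forall i, c i = 0.

Lemma lin_indep_leq n m (e : 'I_n -> E) (x : 'I_m -> E) :
  (forall i, exists c : 'I_n -> k, x i = \sum_j c j *: e j) -> lin_indep x -> (m <= n)%N.
Proof.
move=> /choice[c xE] xI; rewrite leqNgt; apply/negP => nm.
pose A : 'M[k]_(m, n) := \matrix_(i, j) c i j.
have : kermx A != 0.
  by rewrite kermx_eq0 /row_free neq_ltn (leq_ltn_trans (rank_leq_col A)).
move=> /rowV0Pn[v /sub_kermxP vA /negP]; apply; apply/eqP/rowP => i.
rewrite mxE; apply: (xI (fun i => v 0 i)).
under eq_bigr => j _ do rewrite xE scaler_sumr.
rewrite exchange_big big1 // => j _ /=.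
under eq_bigr => l _ do rewrite scalerA.
rewrite -scaler_suml; move/rowP: vA => /(_ j); rewrite !mxE => vAj.
suff -> : \sum_l v 0 l * c l j = 0 by rewrite scale0r.
by rewrite -[RHS]vAj; apply: eq_bigr => l _; rewrite mxE.
Qed.

Lemma ex_spanning (S : set E) n : is_subspace S ->
  (forall m (x : 'I_m -> E), (forall i, S (x i)) -> lin_indep x -> (m <= n)%N) ->
  exists m (x : 'I_m -> E), (forall i, S (x i)) /\
    forall v, S v -> exists c : 'I_m -> k, v = \sum_i c i *: x i.
Proof.
move=> SH S_bound.
pose P m := `[< exists x : 'I_m -> E, (forall i, S (x i)) /\ lin_indep x >].
have exP : exists m, P m by exists 0%N; apply/asboolP; exists (fun=> 0); split=> [[]|c _ []].
have Pn m : P m -> (m <= n)%N by move=> /asboolP[x [Sx xI]]; exact: S_bound Sx xI.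
case: (ex_maxnP exP Pn) => m /asboolP[x [Sx xI]] m_max.
exists m, x; split=> // v Sv; apply: contrapT => nv.
suff: (m.+1 <= m)%N by rewrite ltnn.
apply: m_max; apply/asboolP.
exists (fun i => if unlift ord0 i is Some j then x j else v); split.
  by move=> i; case: unliftP.
move=> c; rewrite (sum_lift ord0) unlift_none.
under eq_bigr => j _ do rewrite liftK.
have [c0|c0] := eqVneq (c ord0) 0.
  rewrite c0 scale0r add0r => /xI xc i.
  by case: (unliftP ord0 i) => [j ->|->].
move=> /eqP; rewrite addr_eq0 => /eqP cv; case: nv.
exists (fun j => - ((c ord0)^-1 * c (lift ord0 j))).
rewrite -[LHS]scale1r -(mulVf c0) -scalerA cv -sumrN scaler_sumr.
by apply: eq_bigr => j _; rewrite scalerN scalerA scaleNr.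
Qed.

End LinearIndependence.

Section BaseChange.
Variables (R L : fieldType) (iota : {rmorphism R -> L}) (G : groupType) (V : rep R G).
Local Notation VL := (base_change iota V).

Lemma base_change_pure g (v : V) c : rep_act VL g (pure iota v c) = pure iota (rep_act V g v) c.
Proof. by rewrite /pure /= tensor_pi_act. Qed.

Definition galg_base (a : galg R G) : galg L G := [seq (iota p.1, p.2) | p <- a].

Lemma galg_base_pure a (v : V) c :
  galg_act (galg_base a) (pure iota v c : VL) = pure iota (galg_act a v) c.
Proof.
rewrite /galg_act big_map pure_suml; apply: eq_bigr => p _ /=.
by rewrite base_change_pure pureZ pure_scale.
Qed.

Lemma contract_act l g (x : VL) :
  contract V l (rep_act VL g x) = rep_act V g (contract V l x).
Proof.
rewrite [x]pure_sum_repr linear_sum 2!raddf_sum linear_sum; apply: eq_bigr => p _.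
by rewrite base_change_pure !contract_pure linearZ.
Qed.

Lemma contract_galg l a (x : VL) :
  contract V l (galg_act (galg_base a) x) = galg_act a (contract V l x).
Proof.
rewrite [x]pure_sum_repr galg_act_sum 2!raddf_sum galg_act_sum; apply: eq_bigr => p _.
by rewrite galg_base_pure !contract_pure linearZ.
Qed.

Lemma galg_base_cat a b : galg_base (a ++ b) = galg_base a ++ galg_base b.
Proof. exact: map_cat. Qed.
Lemma galg_base_scale c a : galg_base (galg_scale c a) = galg_scale (iota c) (galg_base a).
Proof. by rewrite /galg_base /galg_scale -!map_comp; apply: eq_map => p /=; rewrite rmorphM. Qed.
Lemma galg_base_mul g a : galg_base (galg_mul g a) = galg_mul g (galg_base a).
Proof. by rewrite /galg_base /galg_mul -!map_comp. Qed.

End BaseChange.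

(** * Galois action on a base change and descent of subrepresentations *)

Section Descent.
Variables (R : fieldType) (L : closedFieldType) (iota : {rmorphism R -> L}).
Variables (G : groupType) (V : rep R G) (V_irr : irreducible_rep V).
Local Notation VL := (base_change iota V).
Local Notation pure := (@pure R L iota V).

(** Both applications cancel the term of index 0: [n] terms out of [n.+1] remain, and the last
    clause says that such an element of [W] is zero. *)
Lemma minimal_element (W : subrep VL) : (exists2 x, subrep_set W x & x != 0) ->
  exists n (v : 'I_n.+1 -> V) (c : 'I_n.+1 -> L),
  let x := \sum_i pure (v i) (c i) in
  [/\ subrep_set W x, x != 0, reduced iota v c &
    forall (v' : 'I_n -> V) (c' : 'I_n -> L), let y := \sum_i pure (v' i) (c' i) in
    subrep_set W y -> y = 0].
Proof.
move=> [x Wx x0].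
pose len n := `[< exists (v : 'I_n -> V) (c : 'I_n -> L), let y := \sum_i pure (v i) (c i) in
  subrep_set W y /\ y != 0 >].
have ex_len : exists n, len n.
  by have [n [v [c xE]]] := pure_sum_ord x; exists n; apply/asboolP; exists v, c; rewrite /= -xE.
case: (ex_minnP ex_len) => -[|n] /asboolP[v [c [Wy y0]]] min_n.
  by rewrite big_ord0 eqxx in y0.
exists n, v, c; split=> //.
  move=> m v' c' eq_y; apply: min_n; apply/asboolP.
  by exists v', c'; rewrite /= eq_y.
move=> v' c' y Wy'; apply/eqP/negP => /negP y'0.
suff: (n.+1 <= n)%N by rewrite ltnn.
by apply: min_n; apply/asboolP; exists v', c'.
Qed.

(* If x = sum_i v_i (x) c_i is a shortest nonzero element of W, then any a in
   R[G] killing v_0 kills x. *)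
Lemma subrep_meets_invariants (W : subrep VL) (K : set G) (u : V) :
  (exists2 x, subrep_set W x & x != 0) -> u != 0 -> (forall g, K g -> rep_act V g u = u) ->
  exists x, [/\ subrep_set W x, x != 0 & forall g, K g -> rep_act VL g x = x].
Proof.
move=> /minimal_element[n [v [c [Wx x0 red short]]]] u0 Ku.
set x := \sum_i _ in Wx x0 *.
have [l lc] := reduced_functionalr 0 red.
have kill a : galg_act a (v 0) = 0 -> galg_act (galg_base iota a) (x : VL) = 0.
  move=> av0; have W_ax := galg_act_subrep (galg_base iota a) Wx.
  have axE : galg_act (galg_base iota a) (x : VL) =
      \sum_i pure (galg_act a (v (lift 0 i))) (c (lift 0 i)).
    rewrite galg_act_sum (sum_lift 0) galg_base_pure av0 pure0l add0r.
    by apply: eq_bigr => i _; rewrite galg_base_pure.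
  by rewrite axE; apply: short; rewrite -axE.
have v00 : v 0 != 0.
  apply: contraNneq x0 => v00; apply/eqP.
  have := kill [:: (1, 1%g)]; rewrite galg_act1 v00 linear0 => /(_ erefl).
  by rewrite /galg_base /= rmorph1 galg_act1 rep_act1.
have [a ua] := irreducible_cyclic u V_irr v00.
(* Contraction along [c 0] sends [a x] to [a (v 0) = u], which is nonzero. For [g] in [K], [g a - a]
   kills [v 0] because [g u = u], hence it kills [x]. *)
exists (galg_act (galg_base iota a) (x : VL)); split.
- exact: galg_act_subrep.
- apply: contraNneq u0 => /(congr1 (contract V l)).
  by rewrite raddf0 contract_galg (contract_sum v lc) -ua => ->.
move=> g Kg; apply/eqP; rewrite -subr_eq0 -scaleN1r -[-1](rmorphN1 iota).
rewrite -galg_act_mul -galg_act_scale -galg_act_cat -galg_base_mul -galg_base_scale -galg_base_cat.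
apply/eqP/kill; rewrite galg_act_cat galg_act_mul galg_act_scale -ua Ku //.
by rewrite scaleN1r subrr.
Qed.

Fact gal_balanced (s : galois_aut iota) : balanced iota (fun v c => pure v (s c)).
Proof.
split=> [v w c|v c d|r v c]; first exact: pureDl.
  by rewrite raddfD pureDr.
by rewrite pure_scale rmorphM gal_fix.
Qed.

Definition gal_act (s : galois_aut iota) : {additive VL -> VL} := tensor_lift (gal_balanced s).

Lemma gal_act_pure s v c : gal_act s (pure v c) = pure v (s c).
Proof. exact: tensor_lift_pure. Qed.

Lemma gal_actZ s b (x : VL) : gal_act s (b *: x) = s b *: gal_act s x.
Proof.
rewrite [x]pure_sum_repr (@scaler_sumr L VL) 2!raddf_sum (@scaler_sumr L VL); apply: eq_bigr => p _.
by rewrite pureZ !gal_act_pure pureZ rmorphM.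
Qed.

Lemma gal_act_rep s g (x : VL) : gal_act s (rep_act VL g x) = rep_act VL g (gal_act s x).
Proof.
rewrite [x]pure_sum_repr linear_sum 2!raddf_sum linear_sum; apply: eq_bigr => p _.
by rewrite base_change_pure !gal_act_pure base_change_pure.
Qed.

Lemma gal_act_comp s t (x : VL) : gal_act (galois_comp s t) x = gal_act s (gal_act t x).
Proof.
rewrite [x]pure_sum_repr !raddf_sum; apply: eq_bigr => p _.
by rewrite !gal_act_pure.
Qed.

Lemma eq_gal_act (s t : galois_aut iota) (x : VL) : s =1 t -> gal_act s x = gal_act t x.
Proof.
move=> st; rewrite [x]pure_sum_repr !raddf_sum; apply: eq_bigr => p _.
by rewrite !gal_act_pure st.
Qed.

Lemma gal_act_id (x : VL) : gal_act (galois_id iota) x = x.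
Proof.
by rewrite {2}[x]pure_sum_repr {1}[x]pure_sum_repr raddf_sum; apply: eq_bigr => p _; rewrite gal_act_pure.
Qed.

Lemma gal_actK s : cancel (gal_act s) (gal_act (galois_inv s)).
Proof.
move=> x; rewrite -gal_act_comp -[RHS]gal_act_id; apply: eq_gal_act => c /=.
exact: gal_funK.
Qed.

Lemma gal_act_inj s : injective (gal_act s).
Proof. exact: can_inj (gal_actK s). Qed.

Hypothesis L_alg : forall x : L, algebraicOver iota x.
Hypothesis R_perfect : perfect_field R.

(** Scale a shortest element of [W] so that its coefficient of index 0 is 1. Its difference with a
    Galois conjugate loses that term, hence vanishes; so all coefficients lie in [R] and the element
    is [w (x) 1]. Irreducibility of [V] then moves [w] to any vector. *)
Lemma galois_descent (W : subrep VL) : (exists2 x, subrep_set W x & x != 0) ->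
  (forall s x, subrep_set W x -> subrep_set W (gal_act s x)) ->
  forall x, subrep_set W x.
Proof.
move=> /minimal_element[n [v [c [Wx x0 red short]]]] W_gal.
set x := \sum_i _ in Wx x0 *.
have c0 : c 0 != 0.
  have [l lc] := reduced_functionalr 0 red.
  by apply: contra_eq_neq (lc 0) => ->; rewrite raddf0 eqxx eq_sym oner_eq0.
pose d i := (c 0)^-1 * c i.
have yE : (c 0)^-1 *: (x : VL) = \sum_i pure (v i) (d i).
  by rewrite scaler_sumr; apply: eq_bigr => i _; rewrite pureZ.
have d0 : d 0 = 1 by rewrite /d mulVf.
have d_fix i (s : galois_aut iota) : s (d i) = d i.
  have [l lv] := reduced_functionall i red.
  have : \sum_i pure (v i) (s (d i) - d i) = 0.
    rewrite (sum_lift 0) d0 rmorph1 subrr pure0r add0r.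
    apply: short.
    have -> : \sum_j pure (v (lift 0 j)) (s (d (lift 0 j)) - d (lift 0 j)) =
        gal_act s ((c 0)^-1 *: (x : VL)) - (c 0)^-1 *: (x : VL).
      rewrite yE raddf_sum -sumrB (sum_lift 0) gal_act_pure d0 rmorph1 subrr add0r.
      apply: eq_bigr => j _; rewrite gal_act_pure; apply/eqP.
      by rewrite eq_sym subr_eq -pureDr subrK.
    rewrite addrC -scaleN1r; apply: subrepP; last apply: W_gal; exact: subrepZ.
  move=> /(congr1 (coefficient iota l)); rewrite raddf0 (@coefficient_sum _ _ iota _ l _ _ _ _ lv) => /eqP.
  by rewrite subr_eq0 => /eqP.
have /choice[r dr] i : exists r, d i = iota r.
  by apply: (gal_fixed_base L_alg R_perfect) => s; exact: d_fix.
pose w := \sum_i r i *: v i.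
have xw : (c 0)^-1 *: (x : VL) = pure w 1.
  by rewrite yE pure_suml; apply: eq_bigr => i _; rewrite pure_scale dr mulr1.
have w0 : w != 0.
  apply: contraNneq x0 => w0.
  by move/eqP: xw; rewrite w0 pure0l scaler_eq0 invr_eq0 (negbTE c0).
have Ww : subrep_set W (pure w 1) by rewrite -xw; exact: subrepZ.
have Wpure u b : subrep_set W (pure u b).
  have [a ->] := irreducible_cyclic u V_irr w0.
  rewrite -galg_base_pure -[b]mulr1 -pureZ; apply: galg_act_subrep.
  exact: subrepZ.
move=> y; rewrite [y]pure_sum_repr; apply: big_ind => [||p _]; first exact: subrep0.
  by move=> y1 y2; exact: subrepD.
exact: Wpure.
Qed.

End Descent.

(** * Galois conjugates *)

(** Convertible to [invariants], but asks for no topology on [G]. *)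
Definition fixed_by (k : fieldType) (G : groupType) (U : rep k G) (K : set G) : set U :=
  [set u | forall g, K g -> rep_act U g u = u].
Arguments fixed_by {k G} U K.

Section Twist.
Variables (R L : fieldType) (iota : {rmorphism R -> L}) (G : groupType).
Implicit Types s t : galois_aut iota.

Lemma twist_irreducible s (rho : rep L G) : irreducible_rep rho -> irreducible_rep (twist_rep s rho).
Proof.
move=> [[u u0] irr]; split; first by exists u.
move=> N.
have NP (a : L) (v w : rho) : subrep_set N v -> subrep_set N w -> subrep_set N (a *: v + w).
  move=> Nv Nw; have := subrepP (s a) Nv Nw.
  by rewrite -[s a *: _]/(gal_inv s (s a) *: (v : rho)) gal_funK.
pose N' : subrep rho := @Subrep L G rho (subrep_set N) (subrep0 N) NP (@subrep_act _ _ _ N).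
exact: (irr N').
Qed.

(** Twisting keeps the underlying set, so [g] is also linear from the twist by [galois_comp s t] to
    the twist by [s], where [f] takes over. *)
Lemma twist_iso_comp s t (rho : rep L G) : rep_iso (twist_rep s rho) rho ->
  rep_iso (twist_rep t rho) rho -> rep_iso (twist_rep (galois_comp s t) rho) rho.
Proof.
move=> [f [fb fE]] [g [gb gE]].
pose h (x : twist_rep (galois_comp s t) rho) : rho := f (g x).
have h_lin : linear h.
  move=> a x y; rewrite /h.
  have -> : g (a *: x + y) = (a *: (g x : twist_rep s rho) + g y : twist_rep s rho).
    exact: (linearP g (gal_inv s a) x y).
  exact: linearP.
pose hM := GRing.isLinear.Build L (twist_rep (galois_comp s t) rho) rho _ h h_lin.
pose hl : {linear twist_rep (galois_comp s t) rho -> rho} := HB.pack h hM.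
exists hl; split; first exact: (bij_comp fb gb).
by move=> a x; rewrite /= /h -(fE a (g x)); congr (f _); exact: gE.
Qed.

Lemma twist_iso_cancel s t (rho : rep L G) : rep_iso (twist_rep s rho) (twist_rep t rho) ->
  rep_iso (twist_rep (galois_comp (galois_inv t) s) rho) rho.
Proof.
move=> [f [fb fE]].
pose h (x : twist_rep (galois_comp (galois_inv t) s) rho) : rho := f x.
have h_lin : linear h.
  move=> a x y; rewrite /h.
  rewrite -[RHS]/(a *: (f x : rho) + (f y : rho)).
  have := linearP f (t a) x y.
  by rewrite -[t a *: f x]/(gal_inv t (t a) *: (f x : rho)) gal_funK.
pose hM := GRing.isLinear.Build L (twist_rep (galois_comp (galois_inv t) s) rho) rho _ h h_lin.
pose hl : {linear twist_rep (galois_comp (galois_inv t) s) rho -> rho} := HB.pack h hM.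
by exists hl; split=> // a x; exact: fE.
Qed.

(** Irreducible images that share a nonzero vector coincide. A mere equality of two vectors thus
    yields an isomorphism: [e] followed by the inverse of [f]. *)
Lemma common_image_iso (A B M : rep L G) (e : {linear A -> M}) (f : {linear B -> M}) a b :
  irreducible_rep A -> irreducible_rep B -> equivariant e -> equivariant f ->
  e a = f b -> e a != 0 -> exists g : {linear A -> B},
    [/\ bijective g, equivariant g & forall x, f (g x) = e x].
Proof.
move=> irrA irrB eE fE ab a0.
have f_inj : injective f by apply: (Schur_injective (u := b) irrB fE); rewrite -ab.
pose N := [set x | exists y, f y = e x].
have N0 : N 0 by exists 0; rewrite !linear0.
have NP (c : L) x x' : N x -> N x' -> N (c *: x + x').
  by move=> [y yx] [y' yx']; exists (c *: y + y'); rewrite !linearP yx yx'.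
have Nact h x : N x -> N (rep_act A h x).
  by move=> [y yx]; exists (rep_act B h y); rewrite fE yx eE.
have a_neq0 : a != 0 by apply: contraNneq a0 => ->; rewrite linear0.
have Na : N a by exists b.
have /choice[g gP] := irreducible_full (N := Subrep N0 NP Nact) irrA Na a_neq0.
have g_lin : linear g by move=> c x y; apply: f_inj; rewrite linearP !gP linearP.
pose gM := GRing.isLinear.Build L A B _ g g_lin.
pose gl : {linear A -> B} := HB.pack g gM.
have gE : equivariant gl by move=> h x; apply: f_inj; rewrite /= fE !gP eE.
have ga : gl a != 0 by apply: contraNneq a0 => /= ga; rewrite -gP ga linear0.
exists gl; split=> //.
have [g' g'P] := choice (Schur_surjective irrB gE ga).
by exists g' => // x; apply: (Schur_injective irrA gE ga); rewrite g'P.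
Qed.

End Twist.

Section Conjugates.
Variables (R : fieldType) (L : closedFieldType) (iota : {rmorphism R -> L}).
Variables (G : groupType) (V : rep R G) (V_irr : irreducible_rep V).
Hypothesis L_alg : forall x : L, algebraicOver iota x.
Hypothesis R_perfect : perfect_field R.
Local Notation VL := (base_change iota V).

Section TwistMap.
Variables (rho : rep L G) (f : {linear rho -> VL}) (s : galois_aut iota).

(** The semilinear [gal_act V s] becomes linear once its source is twisted by [s]; this realises the
    conjugates of [rho] inside [VL]. *)
Definition twist_map (x : twist_rep s rho) : VL := gal_act V s (f x).

Fact twist_map_linear : linear twist_map.
Proof.
move=> a x y; rewrite /twist_map.
have -> : f (a *: x + y) = gal_inv s a *: f x + f y by exact: (linearP f (gal_inv s a)).
by rewrite raddfD gal_actZ gal_invK.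
Qed.
HB.instance Definition _ := GRing.isLinear.Build L (twist_rep s rho) VL _ twist_map twist_map_linear.

Lemma twist_map_equivariant : equivariant f -> equivariant twist_map.
Proof. by move=> fE g x; rewrite /twist_map -gal_act_rep -fE. Qed.

Lemma twist_map_inj : injective f -> injective twist_map.
Proof. by move=> f_inj x y /gal_act_inj/f_inj. Qed.

End TwistMap.
Local Arguments twist_map {rho} f s x.

Lemma conjugates_span (rho : rep L G) (f : {linear rho -> VL}) (x0 : rho) :
  equivariant f -> f x0 != 0 ->
  forall y, exists l : seq (galois_aut iota * rho), y = \sum_(p <- l) gal_act V p.1 (f p.2).
Proof.
move=> fE fx0.
pose N := [set y | exists l : seq (galois_aut iota * rho), y = \sum_(p <- l) gal_act V p.1 (f p.2)].
have N0 : N 0 by exists [::]; rewrite big_nil.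
have NP (c : L) x x' : N x -> N x' -> N (c *: x + x').
  move=> [l ->] [l' ->]; exists ([seq (p.1, gal_inv p.1 c *: p.2) | p <- l] ++ l').
  rewrite big_cat big_map scaler_sumr; congr (_ + _); apply: eq_bigr => p _ /=.
  by rewrite linearZ gal_actZ gal_invK.
have Nact g x : N x -> N (rep_act VL g x).
  move=> [l ->]; exists [seq (p.1, rep_act rho g p.2) | p <- l].
  rewrite big_map linear_sum; apply: eq_bigr => p _ /=.
  by rewrite fE gal_act_rep.
apply: (galois_descent V_irr L_alg R_perfect (W := Subrep N0 NP Nact)).
  by exists (f x0) => //; exists [:: (galois_id iota, x0)]; rewrite big_seq1 gal_act_id.
move=> s _ [l ->]; exists [seq (galois_comp s p.1, p.2) | p <- l].
by rewrite big_map raddf_sum; apply: eq_bigr => p _; rewrite gal_act_comp.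
Qed.

(** By [conjugates_span], a lift of [i y] is a sum of vectors of conjugates of [om]. Were none of
    these isomorphic to [rho], density with scalar 1 on [rho] and 0 on them would give an [a] that
    fixes [y] and kills the lift, whence [i y = 0]. *)
Lemma irreducible_factor_embeds (om : rep L G) (f : {linear om -> VL}) (x0 : om) (rho : rep L G) :
  irreducible_rep om -> equivariant f -> f x0 != 0 -> irreducible_factor VL rho ->
  exists e : {linear rho -> VL}, injective e /\ equivariant e.
Proof.
move=> om_irr fE fx0 [rho_irr [N [i [i_inj iE]]]]; apply: contrapT => no_emb.
have no_iso (s : galois_aut iota) : ~ rep_iso rho (twist_rep s om).
  move=> [g [gb gE]]; apply: no_emb.
  exists (twist_map f s \o g : {linear rho -> VL}); split.
    by apply: inj_comp (bij_inj gb); apply: twist_map_inj; exact: Schur_injective fx0.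
  by move=> h x /=; rewrite gE twist_map_equivariant.
have [[y y0] _] := rho_irr.
have [l yl] := conjugates_span fE fx0 (repr (i y : quo N)).
pose fam (o : option (galois_aut iota)) := if o is Some s then twist_rep s om else rho.
pose chi (o : option (galois_aut iota)) : L := if o is Some s then 0 else 1.
pose idx (j : option 'I_(size l)) :=
  if j is Some j then Some (nth (galois_id iota, 0) l j).1 else None.
pose x (j : option 'I_(size l)) : fam (idx j) :=
  if j is Some j then (nth (galois_id iota, 0) l j).2 else y.
have fam_irr o : irreducible_rep (fam o) by case: o => [s|//]; exact: twist_irreducible.
have chiP o o' (h : {linear fam o -> fam o'}) u : equivariant h -> h u != 0 -> chi o = chi o'.
  move=> hE hu; have := Schur_iso (fam_irr o) (fam_irr o') hE hu.
  case: o o' {h u hE hu} => [s|] [t|] //= iso; last by have := no_iso _ iso.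
  by have := no_iso _ (rep_iso_sym iso).
have [a aP] := Jacobson_density x fam_irr chiP.
have ay : galg_act a y = y by have := aP None; rewrite scale1r.
have ayl : galg_act a (repr (i y : quo N) : VL) = 0.
  rewrite yl galg_act_sum (big_nth (galois_id iota, 0)) big_mkord big1 // => j _.
  have [aj tE] := (aP (Some j), @twist_map_equivariant om f (nth (galois_id iota, 0) l j).1 fE).
  by have := galg_act_equivariant a (x (Some j)) tE; rewrite aj scale0r linear0.
move/eqP: y0; apply; apply: i_inj.
rewrite linear0 -ay (galg_act_equivariant _ _ iE) -(quo_proj_repr (i y)).
by rewrite -(galg_act_equivariant _ _ (@quo_proj_equivariant _ _ _ N)) ayl linear0.
Qed.

(* The stabiliser of rho in the Galois group contains that of the coefficients
   of f x0, hence is closed. *)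
Lemma fix_rationality_field_iso (rho : rep L G) (f : {linear rho -> VL}) (x0 : rho)
    (t : galois_aut iota) :
  irreducible_rep rho -> equivariant f -> f x0 != 0 ->
  (forall x : rationality_field iota rho, t (rat_val x) = rat_val x) ->
  rep_iso (twist_rep t rho) rho.
Proof.
move=> irr fE fx0 tfix.
pose H := [set s : galois_aut iota | rep_iso (twist_rep s rho) rho].
have [||x Hx|s Hs ts] :=
  @gal_closure R L iota L_alg H [seq p.2 | p <- repr (f x0 : tensor iota V)] t.
- pose h (x : twist_rep (galois_id iota) rho) : rho := x.
  have h_lin : linear h by [].
  pose hM := GRing.isLinear.Build L (twist_rep (galois_id iota) rho) rho _ h h_lin.
  pose hl : {linear twist_rep (galois_id iota) rho -> rho} := HB.pack h hM.
  by exists hl; split=> //; exists id.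
- by move=> s s'; exact: twist_iso_comp.
- have xr : x \in rat_pred iota rho by rewrite unfold_in; apply/asboolP => s; exact: Hx.
  exact: (tfix (RatField xr)).
apply: rep_iso_trans Hs.
(* [t] and [s] agree on the coefficients of [f x0], so the two conjugates of the image of [f] share
   a nonzero vector. *)
have eq_x0 : twist_map f t x0 = twist_map f s x0.
  rewrite /twist_map [f x0]pure_sum_repr !raddf_sum !big_seq; apply: eq_bigr => p px0.
  by rewrite !gal_act_pure ts // map_f.
have [||||||g [gb gE _]] := @common_image_iso L G _ _ VL (twist_map f t) (twist_map f s) x0 x0.
- exact: twist_irreducible.
- exact: twist_irreducible.
- exact: twist_map_equivariant.
- exact: twist_map_equivariant.
- exact: eq_x0.
- by rewrite /= /twist_map raddf_eq0 //; exact: gal_act_inj.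
by exists g.
Qed.

Lemma rat_embedding_eq (rho : rep L G) (w w' : rat_embedding iota rho) : w =1 w' -> w = w'.
Proof.
case: w w' => [[w wc] wb] [[w' wc'] wb'] /= /funext eq_w.
case: w' / eq_w wc' wb' => wc' wb'.
have <- : wc = wc'.
  case: wc {wb} => [[m1] [m2]]; case: wc' {wb'} => [[m1'] [m2']].
  by rewrite (Prop_irrelevance m1 m1') (Prop_irrelevance m2 m2').
by rewrite (Prop_irrelevance wb wb').
Qed.

(** If [s] and [s'] extend [w] and [w'], an isomorphism puts [s'^-1 s] in the stabiliser of [rho],
    which fixes the rationality field by definition. *)
Lemma conjugate_iso_eq (rho : rep L G) (w w' : rat_embedding iota rho) :
  rep_iso (conjugate w) (conjugate w') -> w = w'.
Proof.
move=> /twist_iso_cancel iso; apply: rat_embedding_eq => x.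
have := rat_valP x; rewrite unfold_in => /asboolP/(_ _ iso) /= ssx.
rewrite -(embedding_extP L_alg w x) -(embedding_extP L_alg w' x).
by rewrite -[LHS](gal_invK (embedding_ext w')) ssx.
Qed.

Lemma ex_rat_embedding (rho : rep L G) (s : galois_aut iota) :
  exists w : rat_embedding iota rho, extends_embedding w s.
Proof.
pose f : {rmorphism rationality_field iota rho -> L} := s \o (val : rationality_field iota rho -> L).
have fb r : f (rat_base iota rho r) = iota r by exact: (gal_fix s).
by exists (RatEmbedding fb).
Qed.

Section Multiplicity.
Variables (rho : rep L G) (rho_irr : irreducible_rep rho).

Definition joint m (e : 'I_m -> {linear rho -> VL}) (x : 'I_m -> rho) : VL := \sum_j e j (x j).

Definition jointly_injective m (e : 'I_m -> {linear rho -> VL}) :=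
  (forall j, equivariant (e j)) /\
  (forall x, joint e x = 0 -> forall j, x j = 0).

(** The sum of the [m] copies is the whole [rho]-isotypic part of [VL]; [joint_maximal_of] derives
    this from the maximality of [m]. *)
Definition joint_maximal m (e : 'I_m -> {linear rho -> VL}) :=
  forall f : {linear rho -> VL}, equivariant f -> forall x, exists y, f x = joint e y.

(** The vectors that [f] sends into the sum form a subrepresentation of [rho]; if it is not
    everything it is zero, and [f] gives one more independent copy. *)
Lemma joint_maximal_of m (e : 'I_m -> {linear rho -> VL}) : jointly_injective e ->
  (forall e' : 'I_m.+1 -> {linear rho -> VL}, ~ jointly_injective e') -> joint_maximal e.
Proof.
move=> [eE einj] emax f fE x; apply: contrapT => nx.
pose N := [set x | exists y, f x = joint e y].
have N0 : N 0 by exists (fun=> 0); rewrite linear0 /joint big1 // => j _; exact: linear0.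
have NP (c : L) u v : N u -> N v -> N (c *: u + v).
  move=> [y yu] [z zv]; exists (fun j => c *: y j + z j).
  rewrite linearP yu zv /joint scaler_sumr -big_split; apply: eq_bigr => j _.
  by rewrite linearP.
have Nact g u : N u -> N (rep_act rho g u).
  move=> [y yu]; exists (fun j => rep_act rho g (y j)).
  by rewrite fE yu /joint linear_sum; apply: eq_bigr => j _; rewrite eE.
have N00 u : N u -> u = 0.
  move=> Nu; apply: contrapT => /eqP u0; apply: nx.
  exact: (irreducible_full (N := Subrep N0 NP Nact) rho_irr Nu u0).
apply: (emax (fun j => if unlift ord0 j is Some j then e j else f)); split.
  by move=> j; case: unliftP => [j' _|_]; [exact: eE|exact: fE].
move=> y; rewrite /joint (sum_lift ord0) unlift_none => y0.
have fy : f (y ord0) = joint e (fun j => - y (lift ord0 j)).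
  apply/eqP; rewrite -subr_eq0 -y0; apply/eqP; congr (_ + _).
  rewrite /joint -sumrN; apply: eq_bigr => j _.
  by rewrite liftK linearN opprK.
have y00 : y ord0 = 0 by apply: N00; eexists; exact: fy.
have ey := einj (fun j => - y (lift ord0 j)); rewrite -fy y00 linear0 in ey.
move=> j; case: (unliftP ord0 j) => [j' ->|-> //].
by apply/eqP; rewrite -oppr_eq0; apply/eqP/ey.
Qed.

End Multiplicity.
End Conjugates.
Arguments twist_map {R L iota G V rho} f s x.

(** * Decomposition of the base change *)

Section DirectSumMap.
Variables (k : fieldType) (G : groupType) (I : Type) (W : I -> rep k G) (M : rep k G).
Variables (r : nat) (ws : 'I_r -> I).

Section Map.
Variable F : forall i, {linear W i -> M}.

Definition dsum_map (x : dsum_rep W) : M := \sum_i F (ws i) (dsum_val (x : dsum W) (ws i)).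

Fact dsum_map_linear : linear dsum_map.
Proof.
move=> a x y; rewrite /dsum_map scaler_sumr -big_split; apply: eq_bigr => i _.
exact: linearP.
Qed.
HB.instance Definition _ := GRing.isLinear.Build k (dsum_rep W) M _ dsum_map dsum_map_linear.

Lemma dsum_map_equivariant : (forall i, equivariant (F i)) -> equivariant dsum_map.
Proof.
by move=> FE g x; rewrite /dsum_map linear_sum; apply: eq_bigr => i _; rewrite -FE.
Qed.

End Map.

Hypothesis ws_bij : bijective ws.

Lemma finite_index : finite_set [set: I].
Proof.
have [v wsK vK] := ws_bij.
apply: (@sub_finite_set _ _ (ws @` [set: 'I_r])); first by move=> i _; exists (v i).
exact/finite_image/finite_finset.
Qed.

Definition mk_dsum (x : forall i, W i) : dsum W :=
  @Dsum k G I W x (sub_finite_set (@subsetT _ _) finite_index).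

Lemma dsum_map_iso (F : forall i, {linear W i -> M}) :
  (forall i, equivariant (F i)) ->
  (forall x : forall i, W i, \sum_i F (ws i) (x (ws i)) = 0 -> forall i, x i = 0) ->
  (forall y, exists x : forall i, W i, y = \sum_i F (ws i) (x (ws i))) ->
  rep_iso (dsum_rep W) M.
Proof.
move=> FE Finj Fsurj; apply: (rep_iso_bij (f := dsum_map F)).
- exact: dsum_map_equivariant.
- apply: linear_injective => x /Finj x0; apply: dsumP => i; exact: x0.
- by move=> y; have [x ->] := Fsurj y; exists (mk_dsum x).
Qed.

End DirectSumMap.
Arguments dsum_map {k G I W M r} ws F x.

Section Decomposition.
Variables (R : fieldType) (L : closedFieldType) (iota : {rmorphism R -> L}).
Variables (G : groupType) (V : rep R G) (V_irr : irreducible_rep V).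
Hypothesis L_alg : forall x : L, algebraicOver iota x.
Hypothesis R_perfect : perfect_field R.
Local Notation VL := (base_change iota V).
Local Notation pure := (@pure R L iota V).

(** In a reduced expression of [x] each [v i] is a contraction of [x], hence is fixed by [K] too:
    invariants commute with base change. *)
Lemma base_change_fixed (K : set G) n (e : 'I_n -> V) :
  (forall v, fixed_by V K v -> exists c : 'I_n -> R, v = \sum_i c i *: e i) ->
  forall x, fixed_by VL K x -> exists c : 'I_n -> L, x = \sum_i c i *: (pure (e i) 1 : VL).
Proof.
move=> eP x Kx; have [m [v [c [xE red]]]] := ex_reduced (x : tensor iota V).
have Kv i : fixed_by V K (v i).
  have [l lc] := reduced_functionalr i red.
  by move=> g Kg; rewrite -(contract_sum v lc) -xE -contract_act Kx.
have /choice[d dE] i := eP _ (Kv i).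
exists (fun j => \sum_i iota (d i j) * c i).
rewrite xE; under eq_bigr => i _ do rewrite dE pure_suml.
rewrite exchange_big; apply: eq_bigr => j _ /=.
rewrite scaler_suml; apply: eq_bigr => i _.
by rewrite pure_scale pureZ mulr1.
Qed.

Variables (K : set G) (u : V) (n : nat) (e : 'I_n -> V).
Hypothesis u0 : u != 0.
Hypothesis Ku : fixed_by V K u.
Hypothesis eP : forall v, fixed_by V K v -> exists c : 'I_n -> R, v = \sum_i c i *: e i.

Lemma fixed_lin_indep m (x : 'I_m -> VL) :
  (forall i, fixed_by VL K (x i)) -> lin_indep x -> (m <= n)%N.
Proof.
move=> Kx; apply: (lin_indep_leq (e := fun j => pure (e j) 1 : VL)) => i.
exact: (base_change_fixed eP (Kx i)).
Qed.

(** [W] is a nonzero subrepresentation with the fewest independent [K]-fixed vectors, and [om] is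
    generated by one of these, [x]. A nonzero [N'] inside [om] has as many as [W], so it contains
    [x] and is all of [om]. *)
Lemma ex_irreducible_sub : exists (om : rep L G) (f : {linear om -> VL}) (x0 : om),
  [/\ irreducible_rep om, equivariant f & f x0 != 0].
Proof.
pose indep (W : subrep VL) m := exists x : 'I_m -> VL,
  [/\ forall i, subrep_set W (x i), forall i, fixed_by VL K (x i) & lin_indep x].
pose small m := `[< exists W : subrep VL, (exists2 x, subrep_set W x & x != 0) /\ ~ indep W m.+1 >].
have ex_small : exists m, small m.
  exists n; apply/asboolP; exists (full_subrep VL); split.
    exists (pure u 1) => //; apply: contraNneq u0 => pu0.
    have [||l [l1 _]] := @ex_functional R (over_base iota) [set 0] (1 : L).
    - by split=> // a v w -> ->; rewrite scaler0 addr0.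
    - by move=> /eqP; rewrite oner_eq0.
    by have := contract_pure l u 1; rewrite pu0 raddf0 l1 scale1r => <-.
  move=> [x [_ Kx xI]]; have := fixed_lin_indep Kx xI; by rewrite ltnn.
case: (ex_minnP ex_small) => m /asboolP[W [Wn0 nW]] min_m.
have [x [Wx x0 Kx]] := subrep_meets_invariants V_irr Wn0 u0 Ku.
pose f := subrep_incl (cyclic_subrep x).
have fE : equivariant f by exact: subrep_incl_equivariant.
have [x1 fx1] := (subrep_inclP (cyclic_subrep x) x).1 (cyclic_subrep_id x).
exists (subrep_rep (cyclic_subrep x)), f, x1; split=> //; last by rewrite fx1.
split.
  by exists x1; apply: contraNneq x0 => x10; rewrite -fx1 x10 linear0.
move=> N; have [N0|/existsNP[y /not_implyP[Ny y0]]] := pselect (forall y, subrep_set N y -> y = 0).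
  by left; rewrite eqEsubset; split=> [y /N0 //|_ ->]; exact: subrep0.
right; pose N' := image_subrep fE N.
have N'W z : subrep_set N' z -> subrep_set W z.
  move=> [z' _ <-]; apply: (cyclic_subrep_sub Wx); exact/subrep_inclP/(ex_intro _ z').
have N'n0 : exists2 z, subrep_set N' z & z != 0.
  exists (f y); first by exists y.
  apply/eqP => fy; apply: y0; apply: (@subrep_incl_inj _ _ _ (cyclic_subrep x)).
  by rewrite linear0.
have [z [N'z Kz zI]] : indep N' m.
  apply: contrapT => nN'; case: m nN' min_m nW => [|m] nN' min_m nW.
    by apply: nN'; exists (fun=> 0); split=> [[]|[]|c _ []].
  suff: (m.+1 <= m)%N by rewrite ltnn.
  by apply: min_m; apply/asboolP; exists N'.
(* [W] has no [m.+1] independent [K]-fixed vectors, so [x] is a combination of the family [z]. *)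
have N'x : subrep_set N' x.
  apply: contrapT => nx; apply: nW.
  exists (fun i => if unlift ord0 i is Some j then z j else x); split.
  - by move=> i; case: unliftP => // j _; exact: N'W.
  - by move=> i; case: unliftP => // j _; exact: Kz.
  move=> c; rewrite (sum_lift ord0) unlift_none.
  under eq_bigr => j _ do rewrite liftK.
  have [c0|c0] := eqVneq (c ord0) 0.
    rewrite c0 scale0r add0r => /zI zc i.
    by case: (unliftP ord0 i) => [j ->|->].
  move=> /eqP; rewrite addr_eq0 => /eqP cx; case: nx.
  have -> : x = (c ord0)^-1 *: - \sum_j c (lift ord0 j) *: z j.
    by rewrite -cx scalerA mulVf // scale1r.
  rewrite -scaleN1r scalerA; apply: subrepZ.
  apply: big_ind => [||j _]; first exact: subrep0.
    by move=> a b; exact: subrepD.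
  by apply: subrepZ; exact: N'z.
rewrite -subTset => w _.
have [w' Nw' fw] : subrep_set N' (f w).
  by apply: (cyclic_subrep_sub N'x); exact/subrep_inclP/(ex_intro _ w).
by rewrite -(subrep_incl_inj fw).
Qed.

Section Factor.
Variables (rho : rep L G) (rho_irr : irreducible_rep rho).

Lemma conjugate_irreducible (w : rat_embedding iota rho) : irreducible_rep (conjugate w).
Proof. exact: twist_irreducible. Qed.

Definition conjugate_map (f : {linear rho -> VL}) (w : rat_embedding iota rho) :
  {linear conjugate w -> VL} := twist_map f (embedding_ext w).

Lemma conjugate_mapE f w x : conjugate_map f w x = gal_act V (embedding_ext w) (f x).
Proof. by []. Qed.

Lemma conjugate_map_equivariant (f : {linear rho -> VL}) w : equivariant f -> equivariant (conjugate_map f w).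
Proof. exact: twist_map_equivariant. Qed.

Lemma conjugate_map_inj (f : {linear rho -> VL}) w : injective f -> injective (conjugate_map f w).
Proof. exact: twist_map_inj. Qed.

Lemma conjugates_separated (J : finType) (idx : J -> rat_embedding iota rho)
    (x : forall j, conjugate (idx j)) (w : rat_embedding iota rho) :
  exists a, forall j, galg_act a (x j) = (`[<idx j = w>])%:R *: x j.
Proof.
apply: (@Jacobson_density L G (rat_embedding iota rho) (@conjugate R L iota G rho) J idx x
  (fun w' => (`[<w' = w>])%:R)); first exact: conjugate_irreducible.
move=> w1 w2 f v fE fv; suff -> : w1 = w2 by [].
apply: (conjugate_iso_eq L_alg).
by apply: Schur_iso fE fv; exact: conjugate_irreducible.
Qed.

(** An element separating [ws i0] leaves only the terms of index [i0]; their sum is the image, under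
    the injective [gal_act], of a sum covered by [jointly_injective]. *)
Lemma conjugate_maps_direct r (ws : 'I_r -> rat_embedding iota rho)
    m (f : 'I_m -> {linear rho -> VL}) (x : forall i, 'I_m -> conjugate (ws i)) :
  injective ws -> jointly_injective f ->
  \sum_i \sum_j conjugate_map (f j) (ws i) (x i j) = 0 -> forall i j, x i j = 0.
Proof.
move=> ws_inj [fE f_inj] sum0 i0.
have [a aP] := @conjugates_separated ('I_r * 'I_m)%type (fun p => ws p.1) (fun p => x p.1 p.2) (ws i0).
have : galg_act a (\sum_i \sum_j conjugate_map (f j) (ws i) (x i j)) = 0 by rewrite sum0 linear0.
rewrite galg_act_sum (bigD1 i0) //= [X in _ + X]big1 ?addr0 => [|i /eqP ii0]; last first.
  rewrite galg_act_sum big1 // => j _.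
  rewrite -(galg_act_equivariant _ _ (twist_map_equivariant (s := embedding_ext (ws i)) (fE j))).
  by have := aP (i, j); rewrite /= asboolF => [->|/ws_inj //]; rewrite scale0r linear0.
rewrite galg_act_sum (eq_bigr (fun j => gal_act V (embedding_ext (ws i0)) (f j (x i0 j)))); last first.
  move=> j _.
  rewrite -(galg_act_equivariant _ _ (twist_map_equivariant (s := embedding_ext (ws i0)) (fE j))).
  by have := aP (i0, j); rewrite /= asboolT // scale1r => ->.
rewrite -raddf_sum => /eqP; rewrite raddf_eq0; last exact: gal_act_inj.
move=> /eqP; exact: f_inj.
Qed.

Variables (f0 : {linear rho -> VL}) (f0_inj : injective f0) (f0E : equivariant f0).

Lemma fixed_vector : exists y : rho, y != 0 /\ fixed_by rho K y.
Proof.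
have [[y0 y00] _] := rho_irr.
have [|_ [[y _ <-] fy0 Ky]] :=
  @subrep_meets_invariants _ _ _ _ _ V_irr (image_subrep f0E (full_subrep rho)) K u _ u0 Ku.
  exists (f0 y0); first by exists y0.
  by rewrite raddf_eq0.
exists y; split; first by apply: contraNneq fy0 => ->; rewrite linear0.
by move=> g Kg; apply: f0_inj; rewrite f0E Ky.
Qed.

(** The images of one [K]-fixed vector under the [m] copies are independent and [K]-fixed, so
    finiteness of the multiplicity comes from that of the invariants. *)
Lemma jointly_injective_bound m (f : 'I_m -> {linear rho -> VL}) :
  jointly_injective f -> (m <= n)%N.
Proof.
move=> [fE f_inj]; have [y [y0 Ky]] := fixed_vector.
apply: (@fixed_lin_indep m (fun j => f j y)).
  by move=> j g Kg; rewrite -fE Ky.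
move=> c cf j.
have := f_inj (fun j => c j *: y) _ j.
rewrite /joint; under eq_bigr => i _ do rewrite linearZ /=.
move=> /(_ cf) /eqP; by rewrite scaler_eq0 (negbTE y0) orbF => /eqP.
Qed.

Lemma jointly_injective_f0 : jointly_injective (fun _ : 'I_1 => f0).
Proof.
split=> // x; rewrite /joint big_ord1 => /eqP; rewrite raddf_eq0 // => /eqP x0 j.
by rewrite ord1.
Qed.

Lemma ex_joint_maximal : exists m (f : 'I_m.+1 -> {linear rho -> VL}),
  jointly_injective f /\ joint_maximal f.
Proof.
pose P m := `[< exists f : 'I_m -> {linear rho -> VL}, jointly_injective f >].
have exP : exists m, P m by exists 1%N; apply/asboolP; exists (fun=> f0); exact: jointly_injective_f0.
have Pn m : P m -> (m <= n)%N by move=> /asboolP[f]; exact: jointly_injective_bound.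
case: (ex_maxnP exP Pn) => m /asboolP[f f_inj] m_max.
have m0 : (0 < m)%N.
  by apply: m_max; apply/asboolP; exists (fun=> f0); exact: jointly_injective_f0.
case: m m0 f f_inj m_max => // m _ f f_inj m_max.
exists m, f; split=> //; apply: joint_maximal_of => // f' f'_inj.
suff: (m.+2 <= m.+1)%N by rewrite ltnn.
by apply: m_max; apply/asboolP; exists f'.
Qed.

(** The same count, with the conjugates of one fixed vector, makes the embeddings of the rationality
    field finite in number. *)
Lemma embeddings_bound r (ws : 'I_r -> rat_embedding iota rho) : injective ws -> (r <= n)%N.
Proof.
move=> ws_inj; have [y [y0 Ky]] := fixed_vector.
apply: (@fixed_lin_indep r (fun i => conjugate_map f0 (ws i) y)).
  move=> i g Kg; rewrite -conjugate_map_equivariant //.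
  by rewrite -[X in conjugate_map _ _ X]/(rep_act rho g y) Ky.
move=> c c0 i.
have := @conjugate_maps_direct r ws 1 (fun=> f0)
  (fun i _ => c i *: (y : conjugate (ws i))) ws_inj jointly_injective_f0 _ i ord0.
under eq_bigr => j _ do rewrite big_ord1 linearZ /=.
move=> /(_ c0) /eqP; rewrite scaler_eq0 => /orP[/eqP //|].
by rewrite -[_ == 0]/((y : rho) == 0) (negbTE y0).
Qed.

Lemma ex_embeddings : exists r (ws : 'I_r -> rat_embedding iota rho), bijective ws.
Proof.
pose P r := `[< exists ws : 'I_r -> rat_embedding iota rho, injective ws >].
have exP : exists r, P r.
  have [w _] := ex_rat_embedding rho (galois_id iota).
  by exists 0%N; apply/asboolP; exists (fun=> w) => -[].
have Pn r : P r -> (r <= n)%N by move=> /asboolP[ws]; exact: embeddings_bound.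
case: (ex_maxnP exP Pn) => r /asboolP[ws ws_inj] r_max.
have ws_surj w : exists i, ws i = w.
  apply: contrapT => nw; suff: (r.+1 <= r)%N by rewrite ltnn.
  apply: r_max; apply/asboolP.
  exists (fun i => if unlift ord0 i is Some j then ws j else w).
  move=> i j; case: (unliftP ord0 i) => [i' ->|->]; case: (unliftP ord0 j) => [j' ->|->] //.
  - by move=> /ws_inj ->.
  - by move=> wi; case: nw; exists i'.
  - by move=> wi; case: nw; exists j'.
have [g gP] := choice ws_surj.
by exists r, ws, g => // i; apply: ws_inj; rewrite gP.
Qed.

(** By descent, the [s]-conjugates of the image of [f0] span. If [s] extends [w], it is
    [embedding_ext w] composed with a [t] that fixes the rationality field; the twist of [rho] by
    [t] is isomorphic to [rho], so its image lies in the maximal sum. *)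
Lemma conjugate_maps_span r (ws : 'I_r -> rat_embedding iota rho)
    (w_ind : rat_embedding iota rho -> 'I_r) m (f : 'I_m -> {linear rho -> VL}) :
  cancel w_ind ws -> joint_maximal f ->
  forall y, exists x : forall i, 'I_m -> conjugate (ws i),
    y = \sum_i \sum_j conjugate_map (f j) (ws i) (x i j).
Proof.
move=> wsK f_max y.
have [[x0 x00] _] := rho_irr.
have fx0 : f0 x0 != 0 by rewrite raddf_eq0.
have [l ->] := conjugates_span V_irr L_alg R_perfect f0E fx0 y.
pose D := [set y | exists x : forall i, 'I_m -> conjugate (ws i),
    y = \sum_i \sum_j conjugate_map (f j) (ws i) (x i j)].
have [D0 DD] : D 0 /\ forall y1 y2, D y1 -> D y2 -> D (y1 + y2).
  split.
    exists (fun _ _ => 0); rewrite big1 // => i _; rewrite big1 // => j _.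
    exact: linear0.
  move=> _ _ [x1 ->] [x2 ->]; exists (fun i j => x1 i j + x2 i j).
  rewrite -big_split; apply: eq_bigr => i _; rewrite -big_split; apply: eq_bigr => j _.
  by rewrite linearD.
apply: (big_ind D) => // -[s x] _ /=.
have [w ws_w] := ex_rat_embedding rho s.
pose t := galois_comp (galois_inv (embedding_ext w)) s.
have t_fix (z : rationality_field iota rho) : t (rat_val z) = rat_val z.
  by rewrite /= ws_w -(embedding_extP L_alg w z) gal_funK.
have [g [[g' gK g'K] gE]] := rep_iso_sym (fix_rationality_field_iso L_alg rho_irr f0E fx0 t_fix).
have tgE : equivariant (twist_map f0 t \o g).
  by move=> h z /=; rewrite gE twist_map_equivariant.
have [z zE] := f_max _ tgE (g' x).
exists (fun i j => if i == w_ind w then z j else 0).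
rewrite (bigD1 (w_ind w)) //= eqxx [X in _ + X]big1 ?addr0; last first.
  by move=> i /negbTE ->; rewrite big1 // => j _; exact: linear0.
under eq_bigr => j _ do rewrite conjugate_mapE.
rewrite -raddf_sum wsK -/(joint f z) -zE /= g'K /twist_map -gal_act_comp.
by apply: eq_gal_act => c /=; rewrite gal_invK.
Qed.

Theorem base_change_decomposition m (f : 'I_m -> {linear rho -> VL})
    r (ws : 'I_r -> rat_embedding iota rho) :
  bijective ws -> jointly_injective f -> joint_maximal f ->
  rep_iso VL (dsum_rep (fun _ : 'I_m => dsum_rep (fun w : rat_embedding iota rho => conjugate w))).
Proof.
move=> ws_bij f_inj f_max; have [w_ind wsK w_indK] := ws_bij.
apply: rep_iso_sym.
have id_bij : bijective (id : 'I_m -> 'I_m) by exists id.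
apply: (dsum_map_iso id_bij (F := fun j => dsum_map ws (conjugate_map (f j)))).
- by move=> j; apply: dsum_map_equivariant => w; apply: conjugate_map_equivariant; case: f_inj.
- move=> x; rewrite exchange_big /= => /(conjugate_maps_direct (bij_inj ws_bij) f_inj) x0 j.
  by apply: dsumP => w; have := x0 (w_ind w) j; rewrite w_indK.
move=> y; have [x ->] := conjugate_maps_span w_indK f_max y.
have /choice[z zP] (j : 'I_m) : exists z : forall w : rat_embedding iota rho, conjugate w,
    forall i, z (ws i) = x i j.
  (* All conjugates have the underlying set of [rho], which avoids a transport along
     [ws (w_ind w) = w]. *)
  exists (fun w => x (w_ind w) j : rho) => i.
  by rewrite wsK.
exists (fun j => mk_dsum ws_bij (z j)); rewrite exchange_big.
by apply: eq_bigr => j _; apply: eq_bigr => i _; rewrite -zP.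
Qed.

End Factor.

End Decomposition.

(** * Isotypic quotients *)

Section TensorMap.
Variables (R L : fieldType) (iota : {rmorphism R -> L}).

Lemma tensor_lift_linear (V : lmodType R) (M : lmodType L) (f : V -> L -> M)
    (fB : balanced iota f) :
  (forall v b c, f v (b * c) = b *: f v c) -> linear (tensor_lift fB).
Proof.
move=> fZ a x y; rewrite raddfD; congr (_ + _).
rewrite [x]pure_sum_repr scaler_sumr 2!raddf_sum scaler_sumr; apply: eq_bigr => p _.
by rewrite pureZ /= !tensor_lift_pure fZ.
Qed.

Section Map.
Variables (V W : lmodType R) (f : {linear V -> W}).

Fact tensor_map_balanced : balanced iota (fun (v : V) (c : L) => pure iota (f v) c).
Proof.
split=> [v w c|v c d|r v c]; first by rewrite linearD pureDl.
  exact: pureDr.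
by rewrite linearZ pure_scale.
Qed.

Definition tensor_map (x : tensor iota V) : tensor iota W := tensor_lift tensor_map_balanced x.

Fact tensor_map_linear : linear tensor_map.
Proof.
have := @tensor_lift_linear _ _ _ tensor_map_balanced; apply => v b c.
by rewrite pureZ.
Qed.
HB.instance Definition _ :=
  GRing.isLinear.Build L (tensor iota V) (tensor iota W) _ tensor_map tensor_map_linear.

Lemma tensor_map_pure v c : tensor_map (pure iota v c) = pure iota (f v) c.
Proof. exact: tensor_lift_pure. Qed.

Lemma contract_tensor_map l x : contract W l (tensor_map x) = f (contract V l x).
Proof.
rewrite [x]pure_sum_repr linear_sum 2!raddf_sum linear_sum; apply: eq_bigr => p _.
by rewrite /= tensor_map_pure !contract_pure linearZ.
Qed.

Lemma tensor_map_surj : (forall w, exists v, f v = w) -> forall y, exists x, tensor_map x = y.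
Proof.
move=> /choice[g gP] y; exists (\sum_(p <- repr y) pure iota (g p.1) p.2).
rewrite linear_sum [RHS]pure_sum_repr; apply: eq_bigr => p _.
by rewrite /= tensor_map_pure gP.
Qed.

End Map.

Lemma contractZ (V : lmodType R) l r (x : tensor iota V) :
  contract V l (iota r *: x) = r *: contract V l x.
Proof.
rewrite [x]pure_sum_repr scaler_sumr 2!raddf_sum scaler_sumr; apply: eq_bigr => p _.
by rewrite pureZ !contract_pure -over_baseZ linearZ scalerA.
Qed.

End TensorMap.

Section DirectSumProj.
Variables (k : fieldType) (G : groupType) (I : Type) (W : I -> rep k G) (i : I).
Definition dsum_proj (x : dsum_rep W) : W i := dsum_val (x : dsum W) i.
Fact dsum_proj_linear : linear dsum_proj. Proof. by []. Qed.
HB.instance Definition _ := GRing.isLinear.Build k (dsum_rep W) (W i) _ dsum_proj dsum_proj_linear.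
End DirectSumProj.
Arguments dsum_proj {k G I} W i x.

Section IsotypicBaseChange.
Variables (R : fieldType) (L : closedFieldType) (iota : {rmorphism R -> L}).
Variables (G1 G2 : groupType) (pi : rep R G1) (V : rep R (G1 * G2)%type).
Local Notation piL := (base_change iota pi).
Local Notation VL := (base_change iota V).
Local Notation N := (isotypic_ker V pi).

(** For fixed [c] and [l], contracting [e (f (v (x) c))] is an equivariant [R]-linear map of [v]
    from [V] to [pi], so it kills [N]; as [l] is arbitrary, [contract_inj] concludes. *)
Lemma pure_isotypic_ker (rho : rep L G1) (e : {linear rho -> piL}) v c :
  injective e -> equivariant e -> subrep_set N v ->
  subrep_set (isotypic_ker VL rho) (pure iota v c).
Proof.
move=> e_inj eE Nv f fE; apply: e_inj; rewrite linear0; apply: contract_inj => l.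
pose h v := contract pi l (e (f (pure iota v c))).
have h_lin : linear h.
  move=> r x y; rewrite /h pureDl pure_scale -pureZ.
  by rewrite -contractZ -raddfD -linearP -linearP.
pose hM := GRing.isLinear.Build R V pi _ h h_lin.
pose hl : {linear V -> pi} := HB.pack h hM.
apply: (Nv hl) => g x.
by rewrite /= /h -base_change_pure fE eE contract_act.
Qed.

(** A map from [V] to [pi], tensored with [L] and projected to the summands of [piL], gives maps to
    the [rho i]. These kill [x], so the original map kills every contraction of [x]. *)
Lemma contract_isotypic_ker (I J : Type) (rho : I -> rep L G1) x l :
  rep_iso piL (dsum_rep (fun _ : J => dsum_rep rho)) ->
  (forall i, subrep_set (isotypic_ker VL (rho i)) x) ->
  subrep_set N (contract V l x).
Proof.
move=> [phi [phi_bij phiE]] Jx f fE.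
rewrite -contract_tensor_map.
suff -> : tensor_map f x = 0 by rewrite raddf0.
apply: (bij_inj phi_bij); rewrite linear0; apply: dsumP => j; apply: dsumP => i.
pose h : {linear VL -> rho i} :=
  dsum_proj rho i \o (dsum_proj (fun=> dsum_rep rho) j \o
    (phi \o (tensor_map f : {linear VL -> piL}))).
apply: (Jx i h) => g y.
rewrite /h /= -[RHS]/(dsum_val (rep_act (dsum_rep _) g (dsum_val (phi _) j) : dsum rho) i).
have -> : tensor_map f (rep_act VL (g, 1%g) y) = rep_act piL g (tensor_map f y).
  rewrite [y]pure_sum_repr !linear_sum; apply: eq_bigr => p _.
  by rewrite /= base_change_pure !tensor_map_pure base_change_pure fE.
by rewrite phiE.
Qed.

End IsotypicBaseChange.

Lemma rep_iso_same_kernel (k : fieldType) (G : groupType) (A B C : rep k G)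
    (f : {linear A -> B}) (g : {linear A -> C}) :
  equivariant f -> equivariant g ->
  (forall b, exists a, f a = b) -> (forall c, exists a, g a = c) ->
  (forall a, f a = 0 <-> g a = 0) -> rep_iso B C.
Proof.
move=> fE gE /choice[s sP] g_surj fg.
have key a a' : f a = f a' -> g a = g a'.
  move=> /eqP; rewrite -subr_eq0 -linearB => /eqP/fg; rewrite linearB => /eqP.
  by rewrite subr_eq0 => /eqP.
pose h b := g (s b).
have h_lin : linear h.
  by move=> c x y; rewrite /h -linearP; apply: key; rewrite linearP !sP.
pose hM := GRing.isLinear.Build k B C _ h h_lin.
pose hl : {linear B -> C} := HB.pack h hM.
apply: (rep_iso_bij (f := hl)).
- by move=> x b; rewrite /= /h -gE; apply: key; rewrite fE !sP.
- by apply: linear_injective => b /= /fg; rewrite sP.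
- by move=> c; have [a <-] := g_surj c; exists (f a); apply: key; rewrite sP.
Qed.

Section IsotypicSum.
Variables (R : fieldType) (L : closedFieldType) (iota : {rmorphism R -> L}).
Variables (G1 G2 : groupType) (pi : rep R G1) (V : rep R (G1 * G2)%type).
Local Notation VL := (base_change iota V).
Local Notation N := (isotypic_ker V pi).
Variables (I : Type) (r : nat) (ws : 'I_r -> I) (ws_bij : bijective ws) (rho : I -> rep L G1).
Hypothesis ker_pure : forall i v c, subrep_set N v ->
  subrep_set (isotypic_ker VL (rho i)) (pure iota v c).
Hypothesis ker_contract : forall x l,
  (forall i, subrep_set (isotypic_ker VL (rho i)) x) -> subrep_set N (contract V l x).
Hypothesis separate : forall i0 (x : VL), exists y : VL, forall i (f : {linear VL -> rho i}),
  equivariant1 f -> f y = (`[<i = i0>])%:R *: f x.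

(** Both sides are quotients of [VL], with the same kernel by [ker_pure] and [ker_contract];
    [separate] gives surjectivity onto the sum, as in the Chinese remainder theorem. *)
Lemma isotypic_sum_iso :
  rep_iso (base_change iota (isotypic_quotient V pi))
    (dsum_rep (fun i => isotypic_quotient VL (rho i))).
Proof.
pose q : {linear VL -> base_change iota (isotypic_quotient V pi)} :=
  tensor_map (quo_proj N : {linear V -> isotypic_quotient V pi}).
pose d (x : VL) : dsum_rep (fun i => isotypic_quotient VL (rho i)) :=
  mk_dsum ws_bij (fun i => quo_proj (isotypic_ker VL (rho i)) x).
have d_lin : linear d by move=> a x y; apply: dsumP => i /=; rewrite linearP.
pose dM := GRing.isLinear.Build L VL (dsum_rep (fun i => isotypic_quotient VL (rho i))) _ d d_lin.
pose dl : {linear VL -> dsum_rep (fun i => isotypic_quotient VL (rho i))} := HB.pack d dM.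
apply: (rep_iso_same_kernel (f := q) (g := dl)).
- move=> g x; rewrite [x]pure_sum_repr !linear_sum; apply: eq_bigr => p _.
  rewrite base_change_pure /= !tensor_map_pure base_change_pure; congr (pure _ _ _).
  exact: (@quo_proj_equivariant _ _ _ N).
- by move=> g x; apply: dsumP => i; exact: (@quo_proj_equivariant _ _ _ (isotypic_ker VL (rho i)) g x).
- by apply: tensor_map_surj => v; exists (repr (v : quo N)); exact: quo_proj_repr.
- move=> z.
  have /choice[x xz] i : exists x : VL, quo_proj (isotypic_ker VL (rho i)) x = dsum_val (z : dsum _) i.
    by eexists; exact: quo_proj_repr.
  have /choice[y yP] i := separate i (x i).
  exists (\sum_i y (ws i)); apply: dsumP => i /=; rewrite -xz; apply/eqP.
  rewrite -subr_eq0 -linearB; apply/eqP/quo_proj_eq0 => f fE.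
  have [w wsK wK] := ws_bij.
  rewrite linearB linear_sum (bigD1 (w i)) //= wK yP // asboolT // scale1r.
  rewrite big1 ?addr0 ?subrr // => j /eqP jw; rewrite yP // asboolF ?scale0r // => iwj.
  by apply: jw; rewrite iwj wsK.
move=> x; split=> [qx|dx].
  (* The vectors of a reduced expression of [x] are contractions of [x], hence lie in [N], and
     [ker_pure] applies to each term. *)
  have Nx l : subrep_set N (contract V l x).
    by apply/quo_proj_eq0; rewrite -contract_tensor_map -/(q x) qx raddf0.
  apply: dsumP => i /=; apply/quo_proj_eq0.
  have [n [v [c [xE red]]]] := ex_reduced (x : tensor iota V).
  rewrite xE; apply: big_ind => [||j _]; first exact: subrep0.
    by move=> a b; exact: subrepD.
  have [l lc] := reduced_functionalr j red.
  by apply: ker_pure; rewrite -(contract_sum v lc) -xE.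
apply: contract_inj => l; rewrite contract_tensor_map; apply/quo_proj_eq0/ker_contract => i.
by apply/quo_proj_eq0; have := congr1 (fun z : dsum _ => dsum_val z i) dx.
Qed.

End IsotypicSum.

(** * Separation of the isotypic quotients of a smooth representation *)

Section Smooth.
Variables (R L : fieldType) (iota : {rmorphism R -> L}).
Variables (G1 G2 : topologicalGroupType) (G1_lp : locally_profinite G1).
Variables (V : rep R (G1 * G2)%type) (V_smooth : smooth_rep V).
Local Notation VL := (base_change iota V).

Lemma stabiliser_nbhs1 (G : topologicalGroupType) (U : rep R G) (v : U) :
  smooth_rep U -> nbhs (1%g : G) [set g | rep_act U g v = v].
Proof. by move=> U_smooth; apply: open_nbhs_nbhs; split; [exact: U_smooth|exact: rep_act1]. Qed.

(** [x] involves finitely many vectors of [V]; their stabilisers are pulled back along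
    [g |-> (g, 1)], since the subgroup has to be open in [G1]. *)
Lemma base_change_stabiliser (x : VL) : exists2 K : set G1, compact_open_subgroup K &
  fixed_by (restrict_rep VL) K x.
Proof.
have [K KH KP] : exists2 K : set G1, compact_open_subgroup K &
    K `<=` [set g | rep_act VL (g, 1%g) x = x]; last by exists K.
apply: G1_lp.2.
have [n [v [c xE]]] := pure_sum_ord (x : tensor iota V).
have nbhs_v i : nbhs (1%g : G1) [set g | rep_act V (g, 1%g) (v i) = v i].
  have cont : {for (1%g : G1), continuous (fun g : G1 => (g, 1%g) : (G1 * G2)%type)}.
    by apply: cvg_pair; [exact: cvg_id|exact: cvg_cst].
  exact: (cont _ (@stabiliser_nbhs1 _ V (v i) V_smooth)).
apply: filterS (filter_forall _ nbhs_v) => g gv /=.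
rewrite {1 2}xE linear_sum; apply: eq_bigr => i _.
by rewrite base_change_pure gv.
Qed.

End Smooth.

Section Separation.
Variables (R : fieldType) (L : closedFieldType) (iota : {rmorphism R -> L}).
Hypothesis L_alg : forall x : L, algebraicOver iota x.
Variables (G1 G2 : topologicalGroupType) (G1_lp : locally_profinite G1).
Variables (pi : rep R G1) (pi_adm : admissible_rep pi).
Variables (V : rep R (G1 * G2)%type) (V_smooth : smooth_rep V).
Variables (rho : rep L G1) (rho_irr : irreducible_rep rho).
Variables (f0 : {linear rho -> base_change iota pi}) (f0_inj : injective f0) (f0E : equivariant f0).
Local Notation VL := (base_change iota V).

(** The conjugate embeds in the base change of [pi], where admissibility bounds independent fixed
    vectors. [K] is arbitrary because it will depend on a vector of [VL]. *)
Lemma conjugate_fixed_spanning (K : set G1) (w : rat_embedding iota rho) :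
  compact_open_subgroup K ->
  exists m (b : 'I_m -> conjugate w), (forall i, fixed_by (conjugate w) K (b i)) /\
    forall v, fixed_by (conjugate w) K v -> exists c : 'I_m -> L, v = \sum_i c i *: b i.
Proof.
move=> KH; have [n [e [_ eP]]] := pi_adm.2 K KH.
apply: (ex_spanning (n := n)).
  split=> [g _|a u v Ku Kv g Kg]; first exact: linear0.
  by rewrite linearP Ku // Kv.
move=> m x Kx xI; apply: (fixed_lin_indep eP (x := fun i => conjugate_map f0 w (x i))).
  by move=> i g Kg; rewrite -(conjugate_map_equivariant (w := w) f0E) Kx.
move=> c c0; apply: xI; apply: (conjugate_map_inj (w := w) f0_inj).
rewrite linear0 linear_sum -[RHS]c0; apply: eq_bigr => i _.
by rewrite linearZ.
Qed.

(* f x is fixed by the compact open stabiliser K of x for every f, and the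
   K-fixed vectors of the conjugates of rho are finite dimensional, so that a
   single element of the group algebra separates all the f x. *)
Lemma separate_conjugates r (ws : 'I_r -> rat_embedding iota rho)
    (w0 : rat_embedding iota rho) (x : VL) :
  bijective ws ->
  exists y : VL, forall w (f : {linear VL -> conjugate w}),
    equivariant1 f -> f y = (`[<w = w0>])%:R *: f x.
Proof.
move=> [w_ind _ w_indK].
have [K KH Kx] := base_change_stabiliser G1_lp V_smooth x.
pose sp i := cid (conjugate_fixed_spanning (ws i) KH).
pose m i := projT1 (sp i).
pose b i : 'I_(m i) -> conjugate (ws i) := projT1 (cid (projT2 (sp i))).
have bP i : forall v, fixed_by (conjugate (ws i)) K v ->
    exists c : 'I_(m i) -> L, v = \sum_j c j *: b i j.
  by have [] := projT2 (cid (projT2 (sp i))).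
(* The number of spanning vectors varies with the conjugate, hence the sigma type. The element [a]
   is chosen before [f], so one [y] serves all [f]. *)
have [a aP] := @conjugates_separated R L iota G1 L_alg rho rho_irr {i : 'I_r & 'I_(m i)}
  (fun j => ws (tag j)) (fun j => b (tag j) (tagged j)) w0.
exists (galg_act (U := restrict_rep VL) a x) => w f fE.
rewrite -[LHS]/((f : {linear restrict_rep VL -> conjugate w}) _).
rewrite (@galg_act_equivariant _ _ (restrict_rep VL) _ f) //.
move: f fE; rewrite -(w_indK w); move: (w_ind w) => i f fE.
have [|c ->] := bP i (f x).
  by move=> g Kg; rewrite -fE; congr (f _); exact: Kx.
rewrite galg_act_sum scaler_sumr; apply: eq_bigr => j _.
have := aP (Tagged (fun i => 'I_(m i)) j); rewrite /= => abj.
by rewrite linearZ /= abj !scalerA mulrC.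
Qed.

End Separation.

Theorem theorem3p6
  (R : fieldType) (R_perfect : perfect_field R)
  (L : closedFieldType) (iota : {rmorphism R -> L})
  (L_closure : is_algebraic_closure iota)
  (G1 G2 : topologicalGroupType)
  (G1_lp : locally_profinite G1) (G2_lp : locally_profinite G2)
  (K_exists : exists2 K : set (G1 * G2)%type,
     compact_open_subgroup K & pro_order_invertible R K)
  (pi1 : rep R G1) (pi1_irr : irreducible_rep pi1)
  (pi1_adm : admissible_rep pi1)
  (rho1 : rep L G1) (rho1_smooth : smooth_rep rho1)
  (rho1_factor : irreducible_factor (base_change iota pi1) rho1) :
  (exists m1 : nat, (1 <= m1)%N /\
     rep_iso (base_change iota pi1)
       (dsum_rep (fun _ : 'I_m1 =>
          dsum_rep (fun w : rat_embedding iota rho1 => conjugate w)))) /\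
  forall V : rep R (G1 * G2)%type, smooth_rep V ->
    rep_iso (base_change iota (isotypic_quotient V pi1))
      (dsum_rep (fun w : rat_embedding iota rho1 =>
         isotypic_quotient (base_change iota V) (conjugate w))).
Proof.
have [[u u0] _] := pi1_irr.
(* The stabiliser of a nonzero [u] is open, so some compact open [K] has nonzero invariants in
   [pi1]; [n] then bounds all the counts. *)
have [K KH Ku] := G1_lp.2 _ (stabiliser_nbhs1 u pi1_adm.1).
have [n [e [_ eP]]] := pi1_adm.2 K KH.
have [om [f [x0 [om_irr fE fx0]]]] := ex_irreducible_sub iota pi1_irr u0 Ku eP.
have rho1_irr := rho1_factor.1.
have [f0 [f0_inj f0E]] :=
  irreducible_factor_embeds pi1_irr L_closure R_perfect om_irr fE fx0 rho1_factor.
have [m [g [g_inj g_max]]] := ex_joint_maximal pi1_irr u0 Ku eP rho1_irr f0_inj f0E.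
have [r [ws ws_bij]] := ex_embeddings pi1_irr L_closure u0 Ku eP rho1_irr f0_inj f0E.
have pi1_iso := base_change_decomposition pi1_irr L_closure R_perfect rho1_irr
  f0_inj f0E ws_bij g_inj g_max.
(* At least one copy is present because [f0] itself is an embedding. *)
split; first by exists m.+1.
move=> V V_smooth; apply: (isotypic_sum_iso ws_bij).
- move=> w v c; apply: (pure_isotypic_ker c (conjugate_map_inj (w := w) f0_inj)).
  exact: conjugate_map_equivariant.
- by move=> x l Jx; exact: contract_isotypic_ker pi1_iso Jx.
- move=> w0 x.
  exact: (separate_conjugates L_closure G1_lp pi1_adm V_smooth rho1_irr f0_inj f0E w0 x ws_bij).
Qed.
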